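(* Let $Q=(q_{ij})_{i,j\in E}$ be an irreducible regular $Q$-matrix on a countable state space $E$ and let $H$ be a non-empty finite subset of $E$. Then the $Q$-process is non-ergodic if and only if there is a sequence $\{y^{(n)}\}_{n=1}^{\infty}$ of real-valued functions $y^{(n)}=(y^{(n)}_i)_{i\in E}$ on $E$ satisfying the following conditions: (1) for each $n\ge 1$, $\sup_{i\in E} y^{(n)}_i<\infty$ and $y=y^{(n)}$ solves the inequality $$y_i\le \sum_{j\notin H}\Pi_{ij}\,y_j+\frac{1}{q_i},\qquad i\in E;$$ (2) $\sup_{n\ge 1}\max_{i\in H} y^{(n)}_i=\infty$ (or equivalently, $\varlimsup_{n\to\infty}\max_{i\in H}y^{(n)}_i=\infty$).
   Context: A $Q$-matrix on a countable set $E$ has $q_{ij}\ge 0$ for $i\ne j$ and $q_i:=-q_{ii}=\sum_{j\ne i}q_{ij}<\infty$. It is regular if the associated continuous-time Markov chain (the $Q$-process) $(X_t)_{t\ge0}$ with transition probabilities $p_{ij}(t)$ is unique (non-explosive). The embedding chain is $\Pi=(\Pi_{ij})$, $\Pi_{ij}=q_{ij}/q_i$ for $j\neq i$ and $\Pi_{ii}=0$. The $Q$-process is ergodic if, with $\pi$ its stationary probability distribution, for each $i\in E$, $\sum_{j\in E}|p_{ij}(t)-\pi_j|\to 0$ as $t\to\infty$. Known equivalent description: with $\eta_1$ the first jump time and $\sigma_H=\inf\{t\ge\eta_1: X_t\in H\}$, the process is ergodic iff $\max_{i\in H}\mathbf{E}_i\sigma_H<\infty$ for some (equivalently, any) non-empty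 finite $H\subseteq E$. The functions $y^{(n)}$ are finite-valued but need not be non-negative nor bounded below. *)

(* Defs.v *)
From HB Require Import structures.
From mathcomp Require Import all_boot all_order all_algebra.
From mathcomp Require Import finmap.
From mathcomp Require Import all_classical all_reals all_analysis.
Set Implicit Arguments.
Unset Strict Implicit.
Unset Printing Implicit Defensive.
Import Order.TTheory GRing.Theory Num.Theory.
Import numFieldNormedType.Exports.
Local Open Scope classical_set_scope.
Local Open Scope ring_scope.

(* As the entries of q are real, the second clause makes every
   q_i = - q i i finite: q is totally stable and conservative. *)
Definition Qmatrix (R : realType) (E : countType) (q : E -> E -> R) : Prop :=
  (forall i j, i != j -> 0 <= q i j) /\
  (forall i, \esum_(j in [set j | j != i]) (q i j)%:E = (- q i i)%:E).

(* For a Q-matrix the diagonal entries are nonpositive, so the steps of the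
   path s join distinct states. *)
Definition Qirreducible (R : realType) (E : countType) (q : E -> E -> R) :
    Prop :=
  forall i j, exists s : seq E,
    path (fun a b => 0 < q a b) i s /\ last i s = j.

(* p t i j stands for p_ij(t); only its values at t >= 0 are meaningful. Row
   sums may be < 1, as they are for an explosive minimal process. Continuity at
   0 (standardness) follows from the values and the derivatives there. *)
Definition Qprocess (R : realType) (E : countType) (q : E -> E -> R)
    (p : R -> E -> E -> R) : Prop :=
  [/\ forall (t : R) i j, 0 <= t -> 0 <= p t i j,
      forall (t : R) i, 0 <= t -> (\esum_(j in [set: E]) (p t i j)%:E <= 1)%E,
      forall i j, p 0 i j = (i == j)%:R,
      forall (s t : R) i j, 0 <= s -> 0 <= t ->
        (p (s + t) i j)%:E = \esum_(k in [set: E]) (p s i k * p t k j)%:E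
    & forall i j, (p t i j - (i == j)%:R) / t @[t --> 0^'+] --> q i j].

Definition honest (R : realType) (E : countType) (p : R -> E -> E -> R) :
    Prop :=
  forall (t : R) i, 0 <= t -> \esum_(j in [set: E]) (p t i j)%:E = 1%E.

(* Non-explosive, with a unique Q-process; uniqueness is among all
   (possibly substochastic) Q-processes. *)
Definition Qregular (R : realType) (E : countType) (q : E -> E -> R) : Prop :=
  exists p, [/\ Qprocess q p, honest p
    & forall p', Qprocess q p' -> forall (t : R) i j, 0 <= t -> p' t i j = p t i j].

Definition embedding_chain (R : realType) (E : countType) (q : E -> E -> R)
    (i j : E) : R :=
  if j == i then 0 else q i j / (- q i i).

Definition stationary_distribution (R : realType) (E : countType)
    (p : R -> E -> E -> R) (mu : E -> R) : Prop :=
  [/\ forall i, 0 <= mu i,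
      \esum_(i in [set: E]) (mu i)%:E = 1%E
    & forall (t : R) j, 0 <= t ->
        \esum_(i in [set: E]) (mu i * p t i j)%:E = (mu j)%:E].

Definition ergodic (R : realType) (E : countType) (p : R -> E -> E -> R) :
    Prop :=
  exists mu, stationary_distribution p mu /\
    forall i, (\esum_(j in [set: E]) (`|p t i j - mu j|)%:E)%E
                @[t --> +oo%R] --> 0%E.

(* Sum of a family of arbitrary sign, with value in [-oo, +oo], as the
   difference of the sums of the positive and negative parts (\esum itself is
   only meaningful for nonnegative families). The form +oo - +oo cannot occur
   when the sum of the positive parts is finite. *)
Definition signed_esum (R : realType) (E : countType) (D : set E)
    (f : E -> R) : \bar R :=
  (\esum_(j in D) (Num.max (f j) 0)%:E
     - \esum_(j in D) (Num.max (- f j) 0)%:E)%E.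

(* If y is bounded above then so is the signed sum, whose negative part may be
   infinite. *)
Definition drift_inequality (R : realType) (E : countType) (q : E -> E -> R)
    (H : {fset E}) (y : E -> R) : Prop :=
  forall i, ((y i)%:E <=
    signed_esum [set j | j \notin H] (fun j => embedding_chain q i j * y j)%R
    + ((- q i i)^-1)%:E)%E.

Definition max_on (R : realType) (E : countType) (H : {fset E}) (y : E -> R) :
    \bar R :=
  \big[maxe/-oo%E]_(i <- H) (y i)%:E.

(* Main.v *)
Require Import Defs.
From HB Require Import structures.
From mathcomp Require Import all_boot all_order all_algebra.
From mathcomp Require Import finmap.
From mathcomp Require Import all_classical all_reals all_analysis.
From mathcomp Require Import ring lra.
Set Implicit Arguments.
Unset Strict Implicit.
Unset Printing Implicit Defensive.
Import Order.TTheory GRing.Theory Num.Theory.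
Import numFieldNormedType.Exports.
Local Open Scope classical_set_scope.
Local Open Scope ring_scope.

(** Write q_i = - q_ii.  Truncating x_i = sum_(j notin H) Pi_ij x_j + 1 / q_i to
    growing finite sets of states and iterating from 0 gives finitely supported
    functions x^(n) that increase to i |-> E_i sigma_H and satisfy the drift
    inequality.  If they stay bounded on H, then by irreducibility their limit V
    is finite everywhere and V 1_(H^c) is a Foster-Lyapunov function, so the
    process is ergodic; for a non-ergodic process the x^(n) thus serve as y^(n).
    Conversely, a stationary distribution mu satisfies mu Q <= 0, and testing
    this against x^(n) 1_(H^c) yields mu_h q_h x^(n)_h <= 1 for h in H, so V is
    finite.  If y is a solution bounded above, then u = (y - V)^+ is bounded and
    u <= sum_(j notin H) Pi_ij u_j, hence M - u 1_(H^c) is superharmonic for p(1)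
    and attains its maximum M on H.  By stationarity it is constant, so u = 0 on
    H, that is y <= V there.

    No sample paths are used.  For a finite set A, the probability of staying in
    A up to time t is the infimum, over the partitions t = t_1 + ... + t_m, of
    the products P_A(t_1) ... P_A(t_m) of the truncated transition matrices.  Its
    supremum over A is again a Q-process, the minimal one, so regularity
    identifies it with p, and Lyapunov inequalities pass from the finite
    truncations to p. *)

(** * Sums over countable types *)

(** A Lyapunov inequality for [q] says nothing directly about [p]: the expansion p(h) = I + h q +
    o(h) holds entry by entry, so it is uniform only over finitely many states. Hence the inequality
    is run on a finite set A in steps of length 1/(n+1), and only monotone limits are taken
    afterwards. Refining a partition lowers the product of truncated matrices, by
    Chapman-Kolmogorov, and any two partitions have a common refinement; so the infimum behaves like
    a limit and is multiplicative in time on A.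

    Long-time behaviour is read off the skeleton p(1). All its entries are positive, which excludes
    periodicity; two independent copies and a maximum principle bring its rows together, and real
    times follow because the l1 distance to a stationary distribution cannot increase.

    In the converse direction y need not be bounded below, so sums of y may be -oo. The positive
    part of y - V is bounded, because V is nonnegative and y is bounded above, and everything is
    phrased in terms of it.

    The quotient 1 / q_i makes sense except when q_i = 0; irreducibility then forces [E] to be a
    single point, which is treated apart. *)

Section Esum.
Context {R : realType}.
Implicit Types X Y : choiceType.

Lemma esum_le_fset X (f : X -> R) (c : \bar R) :
  (forall F : {fset X}, ((\sum_(x <- F) f x)%:E <= c)%E) ->
  (\esum_(x in [set: X]) (f x)%:E <= c)%E.
Proof.
move=> h; apply: ge_ereal_sup => _ [D [finD _] <-].
by rewrite fsbig_finite// sumEFin.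
Qed.

Lemma fset_le_esum X (f : X -> R) (F : {fset X}) :
  ((\sum_(x <- F) f x)%:E <= \esum_(x in [set: X]) (f x)%:E)%E.
Proof.
apply: esum_ge; exists [set` F]; first by split.
by rewrite fsbig_finite// set_fsetK sumEFin.
Qed.

Lemma le_esum_at X (f : X -> \bar R) x0 : (forall x, 0 <= f x)%E ->
  (f x0 <= \esum_(x in [set: X]) f x)%E.
Proof.
move=> f0; apply: esum_ge; exists [set x0]; first by split.
by rewrite fsbig_set1.
Qed.

Lemma esum_eq0_at X (f : X -> \bar R) x0 : (forall x, 0 <= f x)%E ->
  \esum_(x in [set: X]) f x = 0%E -> f x0 = 0%E.
Proof.
by move=> f0 e; apply/eqP; rewrite eq_le f0 andbT -e; exact: le_esum_at.
Qed.

Lemma esumZ X (c : R) (f : X -> \bar R) : 0 <= c -> (forall x, 0 <= f x)%E ->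
  \esum_(x in [set: X]) (c%:E * f x)%E = (c%:E * \esum_(x in [set: X]) f x)%E.
Proof.
move=> c0 f0.
(* Stated for any factor [d]: it is applied to [c], and to the inverse of [c] for the reverse
   inequality. *)
have le (d : R) (g : X -> \bar R) : 0 <= d -> (forall x, 0 <= g x)%E ->
    (\esum_(x in [set: X]) (d%:E * g x)%E <= d%:E * \esum_(x in [set: X]) g x)%E.
  move=> d0 g0; apply: ge_ereal_sup => _ [D [finD _] <-].
  rewrite fsbig_finite// -ge0_sume_distrr//.
  apply: lee_wpmul2l; first by rewrite lee_fin.
  by apply: esum_ge; exists D; rewrite ?fsbig_finite.
move: (c0); rewrite le_eqVlt => /orP[/eqP <-|cp].
  by rewrite mul0e esum1// => x _; rewrite mul0e.
apply/eqP; rewrite eq_le le//=.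
have cV : (c%:E * c^-1%:E = 1)%E by rewrite -EFinM divff// gt_eqF.
rewrite -[leRHS]mul1e -cV -muleA; apply: lee_wpmul2l => //.
apply: le_trans (le _ _ _ _); first last.
- by move=> x; rewrite mule_ge0.
- by rewrite invr_ge0.
by apply: le_esum => x _; rewrite muleA (muleC c^-1%:E) cV mul1e.
Qed.

Lemma esum_exchange X Y (a : X -> Y -> \bar R) : (forall x y, 0 <= a x y)%E ->
  \esum_(x in [set: X]) \esum_(y in [set: Y]) a x y =
  \esum_(y in [set: Y]) \esum_(x in [set: X]) a x y.
Proof.
move=> a0; rewrite !esum_esum//.
rewrite (reindex_esum ([set: Y] `*`` fun=> [set: X]) _ (fun z => (z.2, z.1)))//.
split.
- by move=> [y x].
- by move=> [y x] [y' x'] _ _ [-> ->].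
- by move=> [x y] _; exists (y, x).
Qed.

Lemma esum_pair X Y (a : X -> Y -> \bar R) : (forall x y, 0 <= a x y)%E ->
  \esum_(x in [set: X * Y]) a x.1 x.2 =
  \esum_(x in [set: X]) \esum_(y in [set: Y]) a x y.
Proof.
move=> a0; rewrite esum_esum//; congr (esum _ _).
by apply/seteqP; split.
Qed.

Lemma esum_fin X (f : X -> R) (c : R) : (forall x, 0 <= f x) ->
  (\esum_(x in [set: X]) (f x)%:E <= c%:E)%E ->
  exists s : R, \esum_(x in [set: X]) (f x)%:E = s%:E.
Proof.
move=> f0; have : (0 <= \esum_(x in [set: X]) (f x)%:E)%E.
  by apply: esum_ge0 => x _; rewrite lee_fin.
by case: (\esum_(x in _) _) => [s| |]// _ _; exists s.
Qed.

Lemma esum_fineK (X : choiceType) (f : X -> R) (c : R) : (forall x, 0 <= f x) ->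
  (\esum_(x in [set: X]) (f x)%:E <= c%:E)%E ->
  \esum_(x in [set: X]) (f x)%:E = (fine (\esum_(x in [set: X]) (f x)%:E))%:E.
Proof. by move=> f0 /(esum_fin f0)[s ->]. Qed.

Lemma esumZr (X : choiceType) (c : R) (f : X -> R) : 0 <= c ->
  (forall x, 0 <= f x) ->
  \esum_(x in [set: X]) (c * f x)%:E = (c%:E * \esum_(x in [set: X]) (f x)%:E)%E.
Proof.
by move=> c0 f0; rewrite -esumZ.
Qed.

Lemma esumDr (X : choiceType) (f g : X -> R) :
  (forall x, 0 <= f x) -> (forall x, 0 <= g x) ->
  \esum_(x in [set: X]) (f x + g x)%:E =
  (\esum_(x in [set: X]) (f x)%:E + \esum_(x in [set: X]) (g x)%:E)%E.
Proof.
by move=> f0 g0; rewrite -esumD// => x _; rewrite lee_fin.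
Qed.

Lemma esum_eq0r (X : choiceType) (f : X -> R) (x0 : X) : (forall x, 0 <= f x) ->
  \esum_(x in [set: X]) (f x)%:E = 0%E -> f x0 = 0.
Proof.
move=> f0 e; apply: EFin_inj.
by apply: (esum_eq0_at (f := EFin \o f)) => // x; rewrite lee_fin.
Qed.

Lemma dist_esum (X : choiceType) (a b : X -> R) (s t : R) :
  (forall x, 0 <= a x) -> (forall x, 0 <= b x) ->
  \esum_(x in [set: X]) (a x)%:E = s%:E ->
  \esum_(x in [set: X]) (b x)%:E = t%:E ->
  ((`|s - t|)%:E <= \esum_(x in [set: X]) (`|a x - b x|)%:E)%E.
Proof.
have le (f g : X -> R) (u v : R) : (forall x, 0 <= f x) -> (forall x, 0 <= g x) ->
  \esum_(x in [set: X]) (f x)%:E = u%:E ->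
  \esum_(x in [set: X]) (g x)%:E = v%:E ->
  (u%:E <= v%:E + \esum_(x in [set: X]) (`|f x - g x|)%:E)%E.
  move=> f0 g0 <- <-; rewrite -esumDr//; apply: le_esum => x _.
  by rewrite lee_fin -lerBlDl ler_norm.
move=> a0 b0 sa tb.
have := le _ _ _ _ a0 b0 sa tb; have := le _ _ _ _ b0 a0 tb sa.
under eq_esum do rewrite distrC.
case: (\esum_(x in _) _) => [r| |]//; rewrite ?leey// -!EFinD !lee_fin => h1 h2.
by rewrite ler_norml; lra.
Qed.

(** Associativity of row vector times matrix times column vector, by Tonelli: [f] is the product ab
    and [g] the product bc. *)
Lemma esum_assoc (X Y : choiceType) (a : X -> R) (b : X -> Y -> R) (c : Y -> R)
    (f : Y -> R) (g : X -> R) :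
  (forall x, 0 <= a x) -> (forall x y, 0 <= b x y) -> (forall y, 0 <= c y) ->
  (forall y, \esum_(x in [set: X]) (a x * b x y)%:E = (f y)%:E) ->
  (forall x, \esum_(y in [set: Y]) (b x y * c y)%:E = (g x)%:E) ->
  \esum_(x in [set: X]) (a x * g x)%:E = \esum_(y in [set: Y]) (f y * c y)%:E.
Proof.
move=> a0 b0 c0 abf bcg.
transitivity (\esum_(x in [set: X]) \esum_(y in [set: Y])
    (a x * (b x y * c y))%:E).
  apply: eq_esum => x _; rewrite esumZr ?bcg// => y.
  by rewrite mulr_ge0.
rewrite esum_exchange; last by move=> x y; rewrite lee_fin !mulr_ge0.
apply: eq_esum => y _; rewrite mulrC EFinM -abf -esumZr//.
  by apply: eq_esum => x _; congr EFin; ring.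
by move=> x; rewrite mulr_ge0.
Qed.

Lemma esum_delta (X : choiceType) (f : X -> R) x0 : 0 <= f x0 ->
  \esum_(x in [set: X]) (f x * (x == x0)%:R)%:E = (f x0)%:E.
Proof.
move=> f0; rewrite -[RHS](@esum_set1 _ _ x0 (fun x => (f x)%:E))//.
rewrite [RHS]esum_mkcond; apply: eq_esum => x _; rewrite in_set1.
by case: eqP => _; rewrite ?mulr1 ?mulr0.
Qed.

End Esum.

(** * Convergence to a stationary distribution *)

Section MaximumPrinciple.
Context {R : realType}.

(** Summed against the invariant [mu], the inequality KG <= G becomes an equality of finite sums, so
    KG = G wherever [mu] is positive, in particular at [x0]. There the average of G with strictly
    positive weights equals its maximum [c]. *)
Lemma max_principle (X : countType) (K : X -> X -> R) (mu G : X -> R) (c : R)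
    (x0 : X) :
  (forall x y, 0 < K x y) ->
  (forall x, \esum_(y in [set: X]) (K x y)%:E = 1%E) ->
  (forall x, 0 <= mu x) -> 0 < mu x0 ->
  \esum_(x in [set: X]) (mu x)%:E = 1%E ->
  (forall y, \esum_(x in [set: X]) (mu x * K x y)%:E = (mu y)%:E) ->
  (forall x, 0 <= G x <= c) ->
  (forall x, (\esum_(y in [set: X]) (K x y * G y)%:E <= (G x)%:E)%E) ->
  G x0 = c -> forall x, G x = c.
Proof.
move=> K0 K1 mu0 mux0 mu1 muK Gc KG Gx0.
have G0 x : 0 <= G x by case/andP: (Gc x).
have Gle x : G x <= c by case/andP: (Gc x).
have K0' x y : 0 <= K x y by exact/ltW.
pose k x := fine (\esum_(y in [set: X]) (K x y * G y)%:E).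
have kE x : \esum_(y in [set: X]) (K x y * G y)%:E = (k x)%:E.
  by apply: esum_fineK (KG x) => y; rewrite mulr_ge0.
have kG x : k x <= G x by rewrite -lee_fin -kE.
have k0 x : 0 <= k x.
  by rewrite -lee_fin -kE; apply: esum_ge0 => y _; rewrite lee_fin mulr_ge0.
have e : \esum_(x in [set: X]) (mu x * k x)%:E =
         \esum_(y in [set: X]) (mu y * G y)%:E.
  transitivity (\esum_(x in [set: X]) \esum_(y in [set: X])
      (mu x * (K x y * G y))%:E).
    apply: eq_esum => x _; rewrite esumZr// ?kE// => y.
    by rewrite mulr_ge0.
  rewrite esum_exchange; last by move=> x y; rewrite lee_fin !mulr_ge0.
  apply: eq_esum => y _; rewrite mulrC EFinM -muK -esumZr//.
    by apply: eq_esum => x _; rewrite mulrA mulrC.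
  by move=> x; rewrite mulr_ge0.
have [s es] : exists s, \esum_(y in [set: X]) (mu y * G y)%:E = s%:E.
  apply: (@esum_fin _ _ _ c) => [y|]; first by rewrite mulr_ge0.
  rewrite -[leRHS]mule1 -mu1 -esumZr//; last exact: le_trans (Gle x0).
  by apply: le_esum => y _; rewrite lee_fin mulrC ler_wpM2r.
have e0 : \esum_(x in [set: X]) (mu x * (G x - k x))%:E = 0%E.
  have : \esum_(x in [set: X]) (mu x * k x + mu x * (G x - k x))%:E = s%:E.
    by rewrite -es; apply: eq_esum => x _; congr EFin; ring.
  rewrite esumDr ?e ?es.
  - case: (\esum_(x in _) _) => [r| |]//= [sr].
    by congr EFin; lra.
  - by move=> x; rewrite mulr_ge0.
  - by move=> x; rewrite mulr_ge0// subr_ge0.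
have kx0 : k x0 = c.
  have /eqP : mu x0 * (G x0 - k x0) = 0.
    by apply: esum_eq0r e0 => x; rewrite mulr_ge0// subr_ge0.
  by rewrite mulf_eq0 gt_eqF//= subr_eq0 => /eqP <-.
have e1 : \esum_(y in [set: X]) (K x0 y * (c - G y))%:E = 0%E.
  have : \esum_(y in [set: X]) (K x0 y * G y + K x0 y * (c - G y))%:E = c%:E.
    rewrite -[RHS]mule1 -(K1 x0) -esumZr//; last exact: le_trans (Gle x0).
    by apply: eq_esum => y _; congr EFin; ring.
  rewrite esumDr ?kE ?kx0.
  - case: (\esum_(x in _) _) => [r| |]//= [sr].
    by congr EFin; lra.
  - by move=> x; rewrite mulr_ge0.
  - by move=> x; rewrite mulr_ge0// subr_ge0.
move=> y.
have /eqP : K x0 y * (c - G y) = 0.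
  by apply: esum_eq0r e1 => x; rewrite mulr_ge0// subr_ge0.
by rewrite mulf_eq0 gt_eqF//= subr_eq0 => /eqP ->.
Qed.

End MaximumPrinciple.

(** * Rows of the skeleton approach each other in l1 *)

Section Convergence.
Context {R : realType} {E : countType} (p : R -> E -> E -> R).
Hypothesis p_ge0 : forall (t : R) i j, 0 <= t -> 0 <= p t i j.
Hypothesis p_honest : honest p.
Hypothesis p_ck : forall (s t : R) i j, 0 <= s -> 0 <= t ->
  (p (s + t) i j)%:E = \esum_(k in [set: E]) (p s i k * p t k j)%:E.
Hypothesis p1_gt0 : forall i j, 0 < p 1 i j.

Let p1_ge0 i j : 0 <= p 1 i j := ltW (p1_gt0 i j).

Lemma stationary_gt0 (mu : E -> R) : (forall i, 0 <= mu i) ->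
  \esum_(i in [set: E]) (mu i)%:E = 1%E ->
  (forall j, \esum_(i in [set: E]) (mu i * p 1 i j)%:E = (mu j)%:E) ->
  forall j, 0 < mu j.
Proof.
move=> mu0 mu1 muP j.
have [i mui] : exists i, 0 < mu i.
  apply/not_existsP => h; suff : (1 = 0 :> \bar R)%E.
    by move=> [] /eqP; rewrite oner_eq0.
  rewrite -mu1; apply: esum1 => i _; congr EFin.
  apply/eqP; rewrite eq_le mu0 andbT leNgt; apply/negP; exact: h.
rewrite -lte_fin -muP; apply: (@lt_le_trans _ _ (mu i * p 1 i j)%:E).
  by rewrite lte_fin mulr_gt0.
apply: (@le_esum_at _ _ (fun i => (mu i * p 1 i j)%:E)) => l.
by rewrite lee_fin mulr_ge0.
Qed.

Definition l1dist (f g : E -> R) : \bar R :=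
  \esum_(j in [set: E]) (`|f j - g j|)%:E.

Lemma l1dist_ge0 f g : (0 <= l1dist f g)%E.
Proof. by apply: esum_ge0 => j _; rewrite lee_fin. Qed.

Lemma l1dist_contract t (f g f' g' : E -> R) : 0 <= t ->
  (forall i, 0 <= f i) -> (forall i, 0 <= g i) ->
  (forall j, \esum_(i in [set: E]) (f i * p t i j)%:E = (f' j)%:E) ->
  (forall j, \esum_(i in [set: E]) (g i * p t i j)%:E = (g' j)%:E) ->
  (l1dist f' g' <= l1dist f g)%E.
Proof.
move=> t0 f0 g0 ff gg.
have h j : ((`|f' j - g' j|)%:E <=
    \esum_(i in [set: E]) (`|f i - g i| * p t i j)%:E)%E.
  apply: le_trans (dist_esum _ _ (ff j) (gg j)) _.
  - by move=> i; rewrite mulr_ge0 ?p_ge0.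
  - by move=> i; rewrite mulr_ge0 ?p_ge0.
  apply: le_esum => i _; rewrite lee_fin -mulrBl normrM.
  by rewrite (ger0_norm (p_ge0 _ _ t0)).
apply: le_trans (le_esum (fun j _ => h j)) _.
rewrite esum_exchange; last by move=> x y; rewrite lee_fin mulr_ge0 ?p_ge0.
apply: le_esum => i _; rewrite esumZr//; last by move=> j; exact: p_ge0.
by rewrite p_honest ?mule1.
Qed.

Lemma l1dist_le2 (f g : E -> R) :
  (forall i, 0 <= f i) -> (forall i, 0 <= g i) ->
  \esum_(i in [set: E]) (f i)%:E = 1%E ->
  \esum_(i in [set: E]) (g i)%:E = 1%E -> (l1dist f g <= 2%:E)%E.
Proof.
move=> f0 g0 f1 g1; rewrite (_ : 2%:E = 1 + 1)%E; last first.
  by rewrite -EFinD; congr EFin.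
rewrite -{1}f1 -g1 -esumDr//; apply: le_esum => i _; rewrite lee_fin.
by rewrite (le_trans (ler_normB _ _))// !ger0_norm.
Qed.

Definition rowdist (n : nat) i k := fine (l1dist (p n%:R i) (p n%:R k)).

Lemma rowdistE n i k : l1dist (p n%:R i) (p n%:R k) = (rowdist n i k)%:E.
Proof.
apply: (@esum_fineK _ _ _ 2) => //.
by apply: l1dist_le2 => [j|j||]; rewrite ?p_ge0// p_honest.
Qed.

Lemma rowdist_ge0 n i k : 0 <= rowdist n i k.
Proof. by rewrite fine_ge0// l1dist_ge0. Qed.

Lemma rowdist_le2 n i k : rowdist n i k <= 2.
Proof.
by rewrite -lee_fin -rowdistE; apply: l1dist_le2 => [j|j||];
  rewrite ?p_ge0// p_honest.
Qed.

Lemma rowdistxx n i : rowdist n i i = 0.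
Proof.
by apply: EFin_inj; rewrite -rowdistE; apply: esum1 => j _; rewrite subrr normr0.
Qed.

Lemma rowdist_decr n i k : rowdist n.+1 i k <= rowdist n i k.
Proof.
rewrite -lee_fin -!rowdistE; apply: (@l1dist_contract 1) => // [j|j|j|j].
- exact: p_ge0.
- exact: p_ge0.
- by rewrite -p_ck// -natr1.
- by rewrite -p_ck// -natr1.
Qed.

Lemma prod_stochastic i k :
  \esum_(x in [set: E * E]) (p 1 i x.1 * p 1 k x.2)%:E = 1%E.
Proof.
rewrite (esum_pair (a := fun a b => (p 1 i a * p 1 k b)%:E)); last first.
  by move=> a b; rewrite lee_fin mulr_ge0.
rewrite -[RHS](p_honest i ler01); apply: eq_esum => a _.
by rewrite esumZr// p_honest// mule1.
Qed.

Lemma mulr_esum_snd (f : E -> R) k (a : E) : 0 <= f a ->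
  \esum_(b in [set: E]) (f a * p 1 k b)%:E = (f a)%:E.
Proof. by move=> f0; rewrite esumZr// p_honest// mule1. Qed.

(** One step of two independent copies started at [i] and [k]. As the rows of p(1) have mass 1, both
    rows at time n+1 are averages over the same product measure, and the triangle inequality
    compares them term by term. *)
Lemma rowdist_subharmonic n i k :
  ((rowdist n.+1 i k)%:E <=
   \esum_(x in [set: E * E]) (p 1 i x.1 * p 1 k x.2 * rowdist n x.1 x.2)%:E)%E.
Proof.
have n0 : (0 : R) <= n%:R by [].
have PP0 (x : E * E) : 0 <= p 1 i x.1 * p 1 k x.2 by rewrite mulr_ge0.
have step j : ((`|p n.+1%:R i j - p n.+1%:R k j|)%:E <=
    \esum_(x in [set: E * E])
      (p 1 i x.1 * p 1 k x.2 * `|p n%:R x.1 j - p n%:R x.2 j|)%:E)%E.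
  apply: le_trans (dist_esum
    (a := fun x : E * E => p 1 i x.1 * p 1 k x.2 * p n%:R x.1 j)
    (b := fun x : E * E => p 1 i x.1 * p 1 k x.2 * p n%:R x.2 j) _ _ _ _) _.
  - by move=> x; rewrite mulr_ge0// p_ge0.
  - by move=> x; rewrite mulr_ge0// p_ge0.
  - rewrite (esum_pair (a := fun a b => (p 1 i a * p 1 k b * p n%:R a j)%:E)).
      rewrite -nat1r p_ck//; apply: eq_esum => a _.
      under eq_esum do rewrite mulrAC.
      by rewrite (mulr_esum_snd (f := fun a => p 1 i a * p n%:R a j))// mulr_ge0 ?p_ge0.
    by move=> a b; rewrite lee_fin !mulr_ge0 ?p_ge0.
  - rewrite (esum_pair (a := fun a b => (p 1 i a * p 1 k b * p n%:R b j)%:E)).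
      rewrite esum_exchange; last first.
        by move=> a b; rewrite lee_fin !mulr_ge0 ?p_ge0.
      rewrite -nat1r p_ck//; apply: eq_esum => b _.
      under eq_esum do rewrite -mulrA mulrC.
      by rewrite (mulr_esum_snd (f := fun b => p 1 k b * p n%:R b j))// mulr_ge0 ?p_ge0.
    by move=> a b; rewrite lee_fin !mulr_ge0 ?p_ge0.
  by apply: le_esum => x _; rewrite lee_fin -mulrBr normrM (ger0_norm (PP0 x)).
rewrite -rowdistE; apply: le_trans (le_esum (fun j _ => step j)) _.
rewrite esum_exchange; last by move=> j x; rewrite lee_fin mulr_ge0.
apply: le_esum => x _; rewrite esumZr//.
by rewrite (EFinM _ (rowdist _ _ _)) -rowdistE.
Qed.

(** Complementing in 2, the largest l1 distance of two probability rows, gives the bounded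
    nonnegative superharmonic form that [max_principle] asks for. *)
Lemma codist_superharmonic n i k :
  (\esum_(x in [set: E * E])
     (p 1 i x.1 * p 1 k x.2 * (2 - rowdist n x.1 x.2))%:E
   <= (2 - rowdist n.+1 i k)%:E)%E.
Proof.
have PP0 (x : E * E) : 0 <= p 1 i x.1 * p 1 k x.2 by rewrite mulr_ge0.
have : (\esum_(x in [set: E * E])
    (p 1 i x.1 * p 1 k x.2 * (2 - rowdist n x.1 x.2) +
     p 1 i x.1 * p 1 k x.2 * rowdist n x.1 x.2)%:E = 2%:E)%E.
  rewrite -[RHS]mule1 -(prod_stochastic i k) -esumZr//.
  by apply: eq_esum => x _; congr EFin; ring.
have := rowdist_subharmonic n i k.
rewrite esumDr.
- case: (\esum_(x in _) _) => [r| |]//; case: (\esum_(x in _) _) => [r'| |]//.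
  by rewrite !lee_fin => ? []; lra.
- by move=> x; rewrite mulr_ge0// subr_ge0 rowdist_le2.
- by move=> x; rewrite mulr_ge0// rowdist_ge0.
Qed.

Lemma codist_nondecr i k :
  {homo (fun n => 2 - rowdist n i k) : m n / (m <= n)%N >-> m <= n}.
Proof.
apply/nondecreasing_seqP => n.
by rewrite lerD2l lerN2 rowdist_decr.
Qed.

Lemma cvg_codist_sup i k : (2 - rowdist n i k) @[n --> \oo] -->
  sup (range (fun n => 2 - rowdist n i k)).
Proof.
apply: nondecreasing_cvgn; first exact: codist_nondecr.
by exists 2 => _ [n _ <-]; rewrite gerBl rowdist_ge0.
Qed.

(* The limit D of the distances between the rows i and k is subharmonic for the
   product chain on E * E, and vanishes on the diagonal: the maximum principle
   applies to 2 - D. *)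
Lemma rowdist_cvg0 (mu : E -> R) : (forall i, 0 <= mu i) ->
  \esum_(i in [set: E]) (mu i)%:E = 1%E ->
  (forall j, \esum_(i in [set: E]) (mu i * p 1 i j)%:E = (mu j)%:E) ->
  forall i k, rowdist n i k @[n --> \oo] --> (0 : R).
Proof.
move=> mu0 mu1 muP i k.
have PP0 (x y : E * E) : 0 <= p 1 x.1 y.1 * p 1 x.2 y.2 by rewrite mulr_ge0.
pose G (x : E * E) := sup (range (fun n => 2 - rowdist n x.1 x.2)).
have Gcvg (x : E * E) : (2 - rowdist n x.1 x.2) @[n --> \oo] --> G x.
  exact: cvg_codist_sup.
have leG n (x : E * E) : 2 - rowdist n x.1 x.2 <= G x.
  rewrite -(cvg_lim _ (Gcvg x))//.
  apply: nondecreasing_cvgn_le; first exact: codist_nondecr.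
  by apply/cvg_ex; exists (G x).
have Gc (x : E * E) : 0 <= G x <= 2.
  apply/andP; split.
    by apply: le_trans (leG 0%N x); rewrite subr_ge0 rowdist_le2.
  apply: ge_sup; first by exists (2 - rowdist 0 x.1 x.2), 0%N.
  by move=> _ [n _ <-]; rewrite gerBl rowdist_ge0.
have mu_gt0 := stationary_gt0 mu0 mu1 muP i.
have G2 : G (i, k) = 2.
  apply: (@max_principle _ _ (fun x y : E * E => p 1 x.1 y.1 * p 1 x.2 y.2)
    (fun x => mu x.1 * mu x.2) G 2 (i, i)) => //=.
  - by move=> x y; rewrite mulr_gt0.
  - by move=> x; exact: prod_stochastic.
  - by move=> x; rewrite mulr_ge0.
  - by rewrite mulr_gt0.
  - rewrite (esum_pair (a := fun a b => (mu a * mu b)%:E)).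
      rewrite -[RHS]mu1; apply: eq_esum => a _.
      by rewrite esumZr// mu1 mule1.
    by move=> a b; rewrite lee_fin mulr_ge0.
  - move=> y; rewrite (esum_pair (a := fun a b =>
        (mu a * mu b * (p 1 a y.1 * p 1 b y.2))%:E)); last first.
      by move=> a b; rewrite lee_fin !mulr_ge0.
    rewrite [in RHS]mulrC [RHS]EFinM -(muP y.1) -esumZr// => [|a]; last first.
      by rewrite mulr_ge0.
    apply: eq_esum => a _.
    rewrite [in RHS]mulrC [RHS]EFinM -(muP y.2) -esumZr ?mulr_ge0//.
      by apply: eq_esum => b _; congr EFin; ring.
    by move=> b; rewrite mulr_ge0.
  (* Fatou's argument: for each n the sum over a finite F is at most the value at time n+1, which is
     at most G; then n tends to infinity in the finite sum. *)
  - move=> x; apply: esum_le_fset => F; rewrite lee_fin.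
    have cv : (\sum_(y <- F) p 1 x.1 y.1 * p 1 x.2 y.2 *
        (2 - rowdist n y.1 y.2)) @[n --> \oo] -->
        \sum_(y <- F) p 1 x.1 y.1 * p 1 x.2 y.2 * G y.
      apply: cvg_big => //; first exact: add_continuous.
      by move=> y _; apply: cvgMr; exact: Gcvg.
    rewrite -(cvg_lim _ cv)//; apply: limr_le.
      by apply/cvg_ex; eexists; exact: cv.
    near=> n; apply: le_trans (leG n.+1 x); rewrite -lee_fin.
    apply: le_trans (codist_superharmonic n x.1 x.2).
    exact: (fset_le_esum (fun y : E * E =>
      p 1 x.1 y.1 * p 1 x.2 y.2 * (2 - rowdist n y.1 y.2))).
  - apply/eqP; rewrite eq_le; have /andP[_ ->] := Gc (i, i).
    by apply: le_trans (leG 0%N (i, i)); rewrite rowdistxx subr0.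
have := Gcvg (i, k); rewrite G2 /= => h.
have -> : rowdist^~ i ^~ k = (fun n => 2 - (2 - rowdist n i k)).
  by apply/funext => n; rewrite opprB addrC subrK.
have -> : (0 : R) = 2 - 2 by rewrite subrr.
by apply: cvgB => //; exact: cvg_cst.
Unshelve. all: by end_near.
Qed.

End Convergence.

Section Ergodicity.
Context {R : realType} {E : countType} (p : R -> E -> E -> R).
Hypothesis p_ge0 : forall (t : R) i j, 0 <= t -> 0 <= p t i j.
Hypothesis p_honest : honest p.
Hypothesis p_id : forall i j, p 0 i j = (i == j)%:R.
Hypothesis p_ck : forall (s t : R) i j, 0 <= s -> 0 <= t ->
  (p (s + t) i j)%:E = \esum_(k in [set: E]) (p s i k * p t k j)%:E.
Hypothesis p1_gt0 : forall i j, 0 < p 1 i j.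

Lemma p_le1 t i j : 0 <= t -> p t i j <= 1.
Proof.
move=> t0; rewrite -lee_fin -(p_honest i t0).
apply: (@le_esum_at _ _ (fun j => (p t i j)%:E)) => k.
by rewrite lee_fin p_ge0.
Qed.

Section Stationary.
Variable mu : E -> R.
Hypothesis mu_ge0 : forall i, 0 <= mu i.
Hypothesis mu1 : \esum_(i in [set: E]) (mu i)%:E = 1%E.
Hypothesis muP : forall j, \esum_(i in [set: E]) (mu i * p 1 i j)%:E = (mu j)%:E.

Lemma stationary_nat n j :
  \esum_(i in [set: E]) (mu i * p n%:R i j)%:E = (mu j)%:E.
Proof.
elim: n j => [|n IH] j.
  by under eq_esum do rewrite p_id; rewrite esum_delta.
rewrite -IH; apply: (esum_assoc (b := p 1)) => //.
- by move=> i k; exact: p_ge0.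
- by move=> k; exact: p_ge0.
- by move=> i; rewrite -nat1r p_ck.
Qed.

(** By invariance [mu] is the [mu]-average of the rows at time n, so its distance to row [i] is at
    most the [mu]-average of the distances between rows. These tend to 0 and are bounded by 2. *)
Lemma near_l1dist_stationary i (e : R) : 0 < e ->
  \forall n \near \oo, (l1dist (p n%:R i) mu <= e%:E)%E.
Proof.
move=> e0.
have D0 n k : 0 <= rowdist p n i k by exact: rowdist_ge0.
have D2 n k : 0 <= 2 - rowdist p n i k by rewrite subr_ge0; exact: rowdist_le2.
have le n : (l1dist (p n%:R i) mu <=
    \esum_(k in [set: E]) (mu k * rowdist p n i k)%:E)%E.
  have n0 : (0 : R) <= n%:R by [].
  have h j : ((`|p n%:R i j - mu j|)%:E <=
      \esum_(k in [set: E]) (mu k * `|p n%:R i j - p n%:R k j|)%:E)%E.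
    apply: le_trans (dist_esum (a := fun k => mu k * p n%:R i j)
      (b := fun k => mu k * p n%:R k j) _ _ _ _) _.
    - by move=> k; rewrite mulr_ge0 ?p_ge0.
    - by move=> k; rewrite mulr_ge0 ?p_ge0.
    - under eq_esum do rewrite mulrC.
      by rewrite esumZr ?p_ge0// mu1 mule1.
    - exact: stationary_nat.
    apply: le_esum => k _.
    by rewrite lee_fin -mulrBr normrM (ger0_norm (mu_ge0 k)).
  apply: le_trans (le_esum (fun j _ => h j)) _.
  rewrite esum_exchange; last by move=> j k; rewrite lee_fin mulr_ge0.
  apply: le_esum => k _; rewrite esumZr// (EFinM _ (rowdist _ _ _ _)).
  by rewrite -(rowdistE p_ge0 p_honest).
(* Dominated convergence by hand: in the limit the complements 2 - [rowdist] contribute more than 2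
   - e/2 over F, hence eventually more than 2 - e out of a total of 2, which leaves at most e for
   the distances. *)
have [F hF] : exists F : {fset E}, 1 - e / 4 < \sum_(k <- F) mu k.
  have : ((1 - e / 4)%:E < \esum_(k in [set: E]) (mu k)%:E)%E.
    by rewrite mu1 lte_fin; lra.
  move=> /ereal_sup_gt[_ [D [finD _] <-]].
  rewrite fsbig_finite// sumEFin lte_fin => h.
  by exists (fset_set D).
have cv : (\sum_(k <- F) mu k * (2 - rowdist p n i k)) @[n --> \oo] -->
    \sum_(k <- F) mu k * (2 - 0).
  apply: cvg_big => //; first exact: add_continuous.
  move=> k _; apply: cvgMr; apply: cvgB; first exact: cvg_cst.
  exact: (rowdist_cvg0 p_ge0 p_honest p_ck p1_gt0 mu_ge0 mu1 muP).
have lt2 : 2 - e < \sum_(k <- F) mu k * (2 - 0).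
  by rewrite subr0 -mulr_suml; lra.
near=> n.
have hn : 2 - e < \sum_(k <- F) mu k * (2 - rowdist p n i k).
  by near: n; exact: cvgr_gt cv _ lt2.
have : \esum_(k in [set: E])
    (mu k * rowdist p n i k + mu k * (2 - rowdist p n i k))%:E = 2%:E.
  rewrite -[RHS]mule1 -mu1 -esumZr//.
  by apply: eq_esum => k _; congr EFin; ring.
rewrite esumDr; last 2 first.
- by move=> k; rewrite mulr_ge0.
- by move=> k; rewrite mulr_ge0.
have := fset_le_esum (fun k => mu k * (2 - rowdist p n i k)) F.
have := le n.
case: (\esum_(x in _) (mu x * rowdist p n i x)%:E) => [r| |];
  case: (\esum_(x in _) _) => [r'| |]//.
rewrite lee_fin => h1 h2 [h3]; apply: le_trans h1 _.
by rewrite lee_fin; move: (ltW hn); lra.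
Unshelve. all: by end_near.
Qed.

End Stationary.

Lemma stationary_unique (mu nu : E -> R) :
  (forall i, 0 <= mu i) -> (forall i, 0 <= nu i) ->
  \esum_(i in [set: E]) (mu i)%:E = 1%E -> \esum_(i in [set: E]) (nu i)%:E = 1%E ->
  (forall j, \esum_(i in [set: E]) (mu i * p 1 i j)%:E = (mu j)%:E) ->
  (forall j, \esum_(i in [set: E]) (nu i * p 1 i j)%:E = (nu j)%:E) ->
  mu =1 nu.
Proof.
move=> mu0 nu0 mu1 nu1 muP nuP j; apply/eqP; rewrite -subr_eq0 -normr_le0.
apply/ler_addgt0Pl => e e0; rewrite addr0.
have e2 : 0 < e / 2 by rewrite divr_gt0.
have [n [n1 n2]] : exists n, (l1dist (p n%:R j) mu <= (e / 2)%:E)%E /\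
    (l1dist (p n%:R j) nu <= (e / 2)%:E)%E.
  have /filter_ex[n [? ?]] : \forall n \near \oo,
      (l1dist (p n%:R j) mu <= (e / 2)%:E)%E /\
      (l1dist (p n%:R j) nu <= (e / 2)%:E)%E.
    apply: filterI; exact: near_l1dist_stationary.
  by exists n.
have at_le (f : E -> R) : (l1dist (p n%:R j) f <= (e / 2)%:E)%E ->
    `|p n%:R j j - f j| <= e / 2.
  move=> h; rewrite -lee_fin; apply: le_trans h.
  exact: (@le_esum_at _ _ (fun k => (`|p n%:R j k - f k|)%:E)).
move/at_le: n1; move/at_le: n2; rewrite !ler_norml; lra.
Qed.

Lemma ergodic_of_stationary (mu : E -> R) : (forall i, 0 <= mu i) ->
  \esum_(i in [set: E]) (mu i)%:E = 1%E ->
  (forall j, \esum_(i in [set: E]) (mu i * p 1 i j)%:E = (mu j)%:E) ->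
  ergodic p.
Proof.
move=> mu0 mu1 muP.
(* mu p(t) is stationary for p(1) too, hence equal to mu. *)
have muPt t j : 0 <= t ->
    \esum_(i in [set: E]) (mu i * p t i j)%:E = (mu j)%:E.
  move=> t0; pose nu j := fine (\esum_(i in [set: E]) (mu i * p t i j)%:E).
  have nuE k : \esum_(i in [set: E]) (mu i * p t i k)%:E = (nu k)%:E.
    apply: (@esum_fineK _ _ _ 1) => [i|]; first by rewrite mulr_ge0 ?p_ge0.
    rewrite -mu1; apply: le_esum => i _.
    by rewrite lee_fin ler_piMr// p_le1.
  rewrite nuE; congr EFin; apply: stationary_unique => //.
  - move=> k; rewrite -lee_fin -nuE; apply: esum_ge0 => i _.
    by rewrite lee_fin mulr_ge0 ?p_ge0.
  - under eq_esum do rewrite -nuE.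
    rewrite esum_exchange; last by move=> x y; rewrite lee_fin mulr_ge0 ?p_ge0.
    rewrite -[RHS]mu1; apply: eq_esum => i _.
    by rewrite esumZr// ?p_honest ?mule1// => k; exact: p_ge0.
  - move=> l; rewrite -nuE.
    transitivity (\esum_(i in [set: E]) (mu i * p (t + 1) i l)%:E).
      apply/esym; apply: (esum_assoc (b := p t)) => //.
      - by move=> i k; exact: p_ge0.
      - by move=> k; exact: p_ge0.
      - by move=> i; rewrite p_ck.
    rewrite addrC; apply: (esum_assoc (b := p 1)) => //.
    - by move=> i k; exact: p_ge0.
    - by move=> k; exact: p_ge0.
    - by move=> i; rewrite p_ck.
exists mu; split; first by split.
move=> i.
(* Applying p(t - n) fixes [mu] and contracts l1 distances, so integer times control all later real
   times. *)
have mono (n : nat) (t : R) : n%:R <= t ->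
    (l1dist (p t i) mu <= l1dist (p n%:R i) mu)%E.
  move=> nt; have tn : 0 <= t - n%:R by rewrite subr_ge0.
  apply: (l1dist_contract p_ge0 p_honest tn) => //.
  - by move=> k; exact: p_ge0.
  - by move=> k; rewrite -p_ck// addrC subrK.
  - by move=> k; exact: muPt.
have near_small e : 0 < e -> \forall t \near +oo, (l1dist (p t i) mu <= e%:E)%E.
  move=> e0; have /filter_ex[n hn] := near_l1dist_stationary mu0 mu1 muP i e0.
  near=> t; apply: le_trans hn; apply: mono.
  by near: t; exact: nbhs_pinfty_ge.
apply: cvg_EFin.
  have := near_small 1 ltr01; apply: filterS => t.
  have := l1dist_ge0 (p t i) mu; rewrite /l1dist.
  by case: (\esum_(x in _) _).
apply/cvgr0Pnorm_le => e e0; have := near_small _ e0; apply: filterS => t /=.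
have := l1dist_ge0 (p t i) mu; rewrite /l1dist.
case: (\esum_(x in _) _) => [r| |]//=; rewrite !lee_fin => r0 re.
by rewrite ger0_norm.
Unshelve. all: by end_near.
Qed.

End Ergodicity.

(** * The minimal process *)

Section FiniteSums.
Context {R : realType}.

Lemma ler_sum_fset (X : choiceType) (A B : {fset X}) (F : X -> R) :
  {subset A <= B} -> (forall x, 0 <= F x) ->
  \sum_(x <- A) F x <= \sum_(x <- B) F x.
Proof.
move=> AB F0; rewrite [leRHS](bigID (mem A))/= -[leLHS]addr0 lerD ?sumr_ge0//.
have AE : perm_eq [seq x <- B | x \in A] A.
  apply: uniq_perm; rewrite ?filter_uniq ?fset_uniq// => x.
  by rewrite mem_filter; case: (boolP (x \in A)) => //= /AB ->.
by rewrite -[leRHS]big_filter (perm_big _ AE).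
Qed.

Lemma ler_sum_at (X : choiceType) (A : {fset X}) (F : X -> R) x :
  x \in A -> (forall x, 0 <= F x) -> F x <= \sum_(y <- A) F y.
Proof.
move=> xA F0.
have -> : F x = \sum_(y <- [fset x]%fset) F y by rewrite big_seq_fset1.
by apply: ler_sum_fset => // y; rewrite inE => /eqP ->.
Qed.

Lemma ler_sum_at2 (X : choiceType) (A : {fset X}) (F : X -> R) x y :
  x \in A -> y \in A -> x != y -> (forall x, 0 <= F x) ->
  F x + F y <= \sum_(z <- A) F z.
Proof.
move=> xA yA xy F0.
have -> : F x + F y = \sum_(z <- (x |` [fset y])%fset) F z.
  by rewrite big_fsetU1 ?inE// big_seq_fset1.
by apply: ler_sum_fset => // z; rewrite !inE => /orP[] /eqP ->.
Qed.

Lemma ler_sum_in (X : eqType) (A : seq X) (F G : X -> R) :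
  (forall x, x \in A -> F x <= G x) -> \sum_(x <- A) F x <= \sum_(x <- A) G x.
Proof. by move=> h; rewrite big_seq [leRHS]big_seq; apply: ler_sum. Qed.

Lemma sum_delta (X : choiceType) (A : {fset X}) (F : X -> R) i : i \in A ->
  \sum_(k <- A) (i == k)%:R * F k = F i.
Proof.
move=> iA; rewrite (big_fsetD1 i)//= eqxx mul1r big1_seq ?addr0// => k /=.
by rewrite !inE eq_sym => /andP[/negPf -> _]; rewrite mul0r.
Qed.

Definition initial_fset (E : countType) (n : nat) : {fset E} :=
  [fset x in pmap pickle_inv (iota 0 n)]%fset.

Lemma in_initial_fset (E : countType) n (x : E) :
  (x \in initial_fset E n) = (choice.pickle x < n)%N.
Proof.
rewrite /initial_fset inE mem_pmap; apply/mapP/idP => [[m]|xn].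
  rewrite mem_iota /= add0n => mn xm.
  by have := @pickle_invK E m; rewrite -xm /= => ->.
by exists (choice.pickle x); [rewrite mem_iota|rewrite pickleK_inv].
Qed.

Lemma initial_fset_sub (E : countType) m n : (m <= n)%N ->
  {subset initial_fset E m <= initial_fset E n}.
Proof. by move=> mn x; rewrite !in_initial_fset => /leq_trans; exact. Qed.

Lemma near_in_initial_fset (E : countType) (x : E) :
  \forall n \near \oo, x \in initial_fset E n.
Proof.
exists (choice.pickle x).+1 => // n /= h; rewrite in_initial_fset.
exact: h.
Qed.

Lemma near_sub_initial_fset (E : countType) (F : seq E) :
  \forall n \near \oo, {subset F <= initial_fset E n}.
Proof.
elim: F => [|x F IH]; first by near=> n.
near=> n => y; rewrite inE => /orP[/eqP ->|].
  by near: n; exact: near_in_initial_fset.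
by move: y; near: n.
Unshelve. all: by end_near.
Qed.

End FiniteSums.

(** * Products of truncated transition matrices over partitions of a time interval *)

Section Taboo.
Context {R : realType} {E : countType} (p : R -> E -> E -> R).
Hypothesis p_ge0 : forall (t : R) i j, 0 <= t -> 0 <= p t i j.
Hypothesis p_id : forall i j, p 0 i j = (i == j)%:R.
Hypothesis p_ck : forall (s t : R) i j, 0 <= s -> 0 <= t ->
  (p (s + t) i j)%:E = \esum_(k in [set: E]) (p s i k * p t k j)%:E.

(* The (i, j) entry of P_A(t_1) ... P_A(t_m), for s = [:: t_1; ...; t_m]; the
   initial state i itself is not required to lie in A. *)
Fixpoint watched (A : {fset E}) (s : seq R) (i j : E) : R :=
  if s is t :: s' then \sum_(k <- A) p t i k * watched A s' k j
  else (i == j)%:R.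

Definition partition_of (t : R) (s : seq R) :=
  all (>= 0) s /\ \sum_(x <- s) x = t.

Lemma partition_of_nil : partition_of 0 [::].
Proof. by split; rewrite ?big_nil. Qed.

Lemma partition_of_cons t s u : 0 <= t -> partition_of u s ->
  partition_of (t + u) (t :: s).
Proof. by move=> t0 [s0 su]; split; rewrite /= ?t0// big_cons su. Qed.

Lemma partition_of_consP t s u : partition_of u (t :: s) ->
  0 <= t /\ partition_of (u - t) s.
Proof.
move=> [/= /andP[t0 s0] su]; split=> //; split => //.
by rewrite -su big_cons addrC addKr.
Qed.

Lemma partition_of_cat t s u r : partition_of t s -> partition_of u r ->
  partition_of (t + u) (s ++ r).
Proof.
by move=> [s0 st] [r0 ru]; split; rewrite ?all_cat ?s0// big_cat/= st ru.
Qed.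

Lemma partition_of_ge0 t s : partition_of t s -> 0 <= t.
Proof. by move=> [/allP s0 <-]; rewrite big_seq; apply: sumr_ge0 => x /s0. Qed.

Lemma watched_ge0 A s i j : all (>= 0) s -> 0 <= watched A s i j.
Proof.
elim: s i => [|t s IH] i /=; first by rewrite ler0n.
by case/andP => t0 s0; apply: sumr_ge0 => k _; rewrite mulr_ge0 ?p_ge0 ?IH.
Qed.

Lemma watched_cat A s r i j : i \in A ->
  watched A (s ++ r) i j = \sum_(k <- A) watched A s i k * watched A r k j.
Proof.
elim: s i => [|t s IH] i iA /=; first by rewrite sum_delta.
under [RHS]eq_bigr do rewrite mulr_suml.
rewrite exchange_big/= big_seq [RHS]big_seq; apply: eq_bigr => k kA.
rewrite IH// mulr_sumr; apply: eq_bigr => l _; exact: mulrA.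
Qed.

Lemma sum_ck_le (A : {fset E}) s t i j : 0 <= s -> 0 <= t ->
  \sum_(k <- A) p s i k * p t k j <= p (s + t) i j.
Proof.
move=> s0 t0; rewrite -lee_fin p_ck//.
exact: (fset_le_esum (fun k => p s i k * p t k j)).
Qed.

Lemma watched_le A s t i j : partition_of t s -> watched A s i j <= p t i j.
Proof.
elim: s t i => [|u s IH] t i /=.
  by move=> [_ <-]; rewrite big_nil p_id.
move=> /partition_of_consP[u0 ps].
have tu : 0 <= t - u by exact: partition_of_ge0 ps.
apply: (@le_trans _ _ (\sum_(k <- A) p u i k * p (t - u) k j)).
  by apply: ler_sum => k _; rewrite ler_wpM2l ?p_ge0 ?IH.
by rewrite (le_trans (sum_ck_le _ _ _ u0 tu))// addrC subrK.
Qed.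

Lemma watched_cons_le A u s r i j : 0 <= u ->
  (forall k, k \in A -> watched A s k j <= watched A r k j) ->
  watched A (u :: s) i j <= watched A (u :: r) i j.
Proof.
by move=> u0 h; apply: ler_sum_in => k kA; rewrite ler_wpM2l ?p_ge0 ?h.
Qed.

(** An extra division point demands membership in A at one more time: the Chapman-Kolmogorov sum
    loses its terms outside A. *)
Lemma watched_split A s t r i j : 0 <= s -> 0 <= t -> all (>= 0) r ->
  watched A [:: s, t & r] i j <= watched A (s + t :: r) i j.
Proof.
move=> s0 t0 r0 /=.
under eq_bigr do rewrite mulr_sumr.
rewrite exchange_big/=; apply: ler_sum => k _.
under eq_bigr do rewrite mulrA.
by rewrite -mulr_suml ler_wpM2r ?watched_ge0// sum_ck_le.
Qed.

Lemma watched0 A s i j : i \in A -> partition_of 0 s ->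
  watched A s i j = (i == j)%:R.
Proof.
elim: s i => [//|u s IH] i iA /partition_of_consP[u0 ps].
have u00 : u = 0.
  have := partition_of_ge0 ps; rewrite sub0r oppr_ge0 => ?.
  by apply: le_anti; apply/andP.
move: ps; rewrite u00 subr0 => ps /=.
by under eq_bigr do rewrite p_id; rewrite sum_delta// IH.
Qed.

(** Makes the infimum over partitions directed, so that one partition can be nearly optimal for
    finitely many entries at once. *)
Lemma common_refinement A t s r : partition_of t s -> partition_of t r ->
  exists2 z, partition_of t z & forall i j, i \in A ->
    watched A z i j <= watched A s i j /\ watched A z i j <= watched A r i j.
Proof.
have [n] := ubnP (size s + size r); elim: n t s r => // n IH t s r.
case: s => [|a s]; case: r => [|b r].
- by exists [::].
- move=> _ p0; have t0 : t = 0 by case: p0 => _ <-; rewrite big_nil.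
  rewrite t0 in p0 * => pr.
  by exists [::] => // i j iA; rewrite [watched A (b :: r) _ _]watched0.
- move=> _ pr p0; have t0 : t = 0 by case: p0 => _ <-; rewrite big_nil.
  rewrite t0 in p0 pr *.
  by exists [::] => // i j iA; rewrite [watched A (a :: s) _ _]watched0.
rewrite [size (a :: s)]/= [size (b :: r)]/= addSn addnS => sn.
move=> /partition_of_consP[a0 ps] /partition_of_consP[b0 pr].
have s0 : all (>= 0) s by case: ps.
have r0 : all (>= 0) r by case: pr.
(* The longer first block is cut where the shorter one ends. Both partitions then start with the
   same block; once it is removed, the total length has dropped by one. *)
have [ab|/ltW ba] := leP a b.
  have ba0 : 0 <= b - a by rewrite subr_ge0.
  have pr' : partition_of (t - a) (b - a :: r).
    have -> : t - a = (b - a) + (t - b) by ring.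
    exact: partition_of_cons.
  have [|z pz hz] := IH (t - a) s (b - a :: r) _ ps pr'.
    by rewrite /= addnS.
  exists (a :: z) => [|i j iA].
    by rewrite -(subrK a t) addrC; exact: partition_of_cons.
  split; first by apply: watched_cons_le => // k kA; case: (hz k j kA).
  apply: le_trans (watched_cons_le _ a0 (r := b - a :: r) _) _.
    by move=> k kA; case: (hz k j kA).
  by apply: le_trans (watched_split _ _ _ a0 ba0 r0) _; rewrite addrC subrK.
have ba0 : 0 <= a - b by rewrite subr_ge0.
have ps' : partition_of (t - b) (a - b :: s).
  have -> : t - b = (a - b) + (t - a) by ring.
  exact: partition_of_cons.
have [|z pz hz] := IH (t - b) (a - b :: s) r _ ps' pr.
  by rewrite /=.
exists (b :: z) => [|i j iA].
  by rewrite -(subrK b t) addrC; exact: partition_of_cons.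
split; last by apply: watched_cons_le => // k kA; case: (hz k j kA).
apply: le_trans (watched_cons_le _ b0 (r := a - b :: s) _) _.
  by move=> k kA; case: (hz k j kA).
by apply: le_trans (watched_split _ _ _ b0 ba0 s0) _; rewrite addrC subrK.
Qed.

(** Cuts the block of [r] that straddles time [s]. Cutting only lowers the product, which is the
    direction needed to bound [confined] at time s + t from below. *)
Lemma split_partition A s t r : 0 <= s -> 0 <= t -> partition_of (s + t) r ->
  exists r1 r2, [/\ partition_of s r1, partition_of t r2 &
    forall i j, i \in A -> watched A (r1 ++ r2) i j <= watched A r i j].
Proof.
elim: r s => [|a r IH] s s0 t0 pr.
  have st0 : s + t = 0 by case: pr => _ <-; rewrite big_nil.
  have [-> ->] : s = 0 /\ t = 0 by split; lra.
  by exists [::], [::]; split => //; exact: partition_of_nil.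
have /partition_of_consP[a0 pr'] := pr.
have r0 : all (>= 0) r by case: pr'.
have [as_|/ltW sa] := leP a s.
  have sa0 : 0 <= s - a by rewrite subr_ge0.
  have [|r1 [r2 [p1 p2 h]]] := IH (s - a) sa0 t0.
    by have -> : s - a + t = s + t - a by ring.
  exists (a :: r1), r2; split => //.
    by rewrite -(subrK a s) addrC; exact: partition_of_cons.
  by move=> i j iA; apply: watched_cons_le => // k kA; exact: h.
have sa0 : 0 <= a - s by rewrite subr_ge0.
exists [:: s], (a - s :: r); split.
- rewrite -[X in partition_of X](addr0 s).
  by apply: partition_of_cons => //; exact: partition_of_nil.
- have -> : t = (a - s) + (s + t - a) by ring.
  exact: partition_of_cons.
- move=> i j iA; apply: le_trans (watched_split _ _ _ s0 sa0 r0) _.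
  by rewrite addrC subrK.
Qed.

Lemma watched_mono A B s i j : {subset A <= B} -> all (>= 0) s ->
  watched A s i j <= watched B s i j.
Proof.
move=> AB; elim: s i => [//|t s IH] i /= /andP[t0 s0].
apply: (@le_trans _ _ (\sum_(k <- A) p t i k * watched B s k j)).
  by apply: ler_sum => k _; rewrite ler_wpM2l ?p_ge0 ?IH.
by apply: ler_sum_fset => // k; rewrite mulr_ge0 ?p_ge0 ?watched_ge0.
Qed.

End Taboo.

(** * The confined transition functions and their increasing limit *)

Section Minimal.
Context {R : realType} {E : countType} (p : R -> E -> E -> R).
Hypothesis p_ge0 : forall (t : R) i j, 0 <= t -> 0 <= p t i j.
Hypothesis p_id : forall i j, p 0 i j = (i == j)%:R.
Hypothesis p_ck : forall (s t : R) i j, 0 <= s -> 0 <= t ->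
  (p (s + t) i j)%:E = \esum_(k in [set: E]) (p s i k * p t k j)%:E.

(* For i in A, the transition function of the process killed on leaving A. *)
Definition confined (A : {fset E}) (t : R) (i j : E) : R :=
  inf [set watched p A s i j | s in partition_of t].

Lemma confined_lbound A t i j :
  has_lbound [set watched p A s i j | s in partition_of t].
Proof. by exists 0 => _ [s [s0 _] <-]; exact: watched_ge0. Qed.

Lemma partition_of1 (t : R) : 0 <= t -> partition_of t [:: t].
Proof. by move=> t0; split; rewrite /= ?t0// big_seq1. Qed.

Lemma confined_nonempty A t i j : 0 <= t ->
  [set watched p A s i j | s in partition_of t] !=set0.
Proof.
by move=> t0; exists (watched p A [:: t] i j), [:: t] => //; exact: partition_of1.
Qed.

Lemma confined_le_watched A t s i j : partition_of t s ->
  confined A t i j <= watched p A s i j.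
Proof. by move=> ps; apply: ge_inf; [exact: confined_lbound|exists s]. Qed.

Lemma le_confined A t i j c : 0 <= t ->
  (forall s, partition_of t s -> c <= watched p A s i j) -> c <= confined A t i j.
Proof.
move=> t0 h; apply: lb_le_inf; first exact: confined_nonempty.
by move=> _ [s ps <-]; exact: h.
Qed.

Lemma confined_ge0 A t i j : 0 <= t -> 0 <= confined A t i j.
Proof.
by move=> t0; apply: le_confined => // s [s0 _]; exact: watched_ge0.
Qed.

Lemma confined_le A t i j : 0 <= t -> confined A t i j <= p t i j.
Proof.
move=> t0; apply: le_trans (confined_le_watched _ _ _ (partition_of1 t0)) _.
by apply: (watched_le p_ge0 p_id p_ck); exact: partition_of1.
Qed.

Lemma confined_mono A B t i j : {subset A <= B} -> 0 <= t ->
  confined A t i j <= confined B t i j.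
Proof.
move=> AB t0; apply: le_confined => // s ps.
apply: le_trans (confined_le_watched _ _ _ ps) _.
by case: ps => s0 _; exact: watched_mono.
Qed.

Lemma confined_approx A t e : 0 <= t -> 0 < e ->
  exists2 s, partition_of t s & forall i j, i \in A -> j \in A ->
    watched p A s i j <= confined A t i j + e.
Proof.
move=> t0 e0.
suff [s ps h] : exists2 s, partition_of t s &
    forall x, x \in [seq (i, j) | i <- A, j <- A] ->
    watched p A s x.1 x.2 <= confined A t x.1 x.2 + e.
  exists s => // i j iA jA; apply: (h (i, j)).
  by apply/allpairsP; exists (i, j).
have : {in [seq (i, j) | i <- A, j <- A], forall x, x.1 \in A}.
  by move=> x /allpairsP[[i j] [/= iA _ ->]].
elim: [seq _ | _ <- _, _ <- _] => [|x l IH] lA.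
  by exists [:: t] => //; exact: partition_of1.
have [|s ps hs] := IH; first by move=> y yl; apply: lA; rewrite inE yl orbT.
have [_ [r pr <-] hr] : exists2 z,
    [set watched p A s x.1 x.2 | s in partition_of t] z &
    z < confined A t x.1 x.2 + e.
  apply: inf_adherent => //; split; first exact: confined_nonempty.
  exact: confined_lbound.
have [z pz hz] := common_refinement p_ge0 p_id p_ck A ps pr.
exists z => // y yl; have yA := lA _ yl.
have [z1 z2] := hz y.1 y.2 yA.
move: yl z2; rewrite inE => /orP[/eqP -> z2|yl _].
  exact: le_trans z2 (ltW hr).
exact: le_trans z1 (hs _ yl).
Qed.

(** For [>=], any partition of s + t is cut at [s]; for [<=], nearly optimal partitions of [s] and
    [t] are concatenated. *)
Lemma confinedD A s t i j : i \in A -> j \in A -> 0 <= s -> 0 <= t ->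
  confined A (s + t) i j = \sum_(k <- A) confined A s i k * confined A t k j.
Proof.
move=> iA jA s0 t0; apply/eqP; rewrite eq_le; apply/andP; split; last first.
  apply: le_confined; first exact: addr_ge0.
  move=> r pr; have [r1 [r2 [p1 p2 h]]] := split_partition p_ge0 p_ck A s0 t0 pr.
  apply: le_trans (h i j iA); rewrite (watched_cat p r1 r2 j iA).
  by apply: ler_sum => k _; rewrite ler_pM ?confined_ge0 ?confined_le_watched.
(* The error allowed in all entries of both factors is 1/(n+1); it disappears in the limit because A
   is finite. *)
have cv : (\sum_(k <- A) (confined A s i k + @harmonic R n) *
    (confined A t k j + @harmonic R n)) @[n --> \oo] -->
    \sum_(k <- A) (confined A s i k + 0) * (confined A t k j + 0).
  apply: cvg_big => //; first exact: add_continuous.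
  move=> k _; apply: cvgM; (apply: cvgD; first exact: cvg_cst);
    exact: cvg_harmonic.
have -> : \sum_(k <- A) confined A s i k * confined A t k j =
    \sum_(k <- A) (confined A s i k + 0) * (confined A t k j + 0).
  by apply: eq_bigr => k _; rewrite !addr0.
rewrite -(cvg_lim _ cv)//; apply: limr_ge.
  by apply/cvg_ex; eexists; exact: cv.
apply: nearW => n; have e0 : 0 < @harmonic R n by rewrite invr_gt0.
have [r1 p1 h1] := confined_approx A s0 e0.
have [r2 p2 h2] := confined_approx A t0 e0.
apply: le_trans (confined_le_watched _ _ _ (partition_of_cat p1 p2)) _.
rewrite (watched_cat p r1 r2 j iA); apply: ler_sum_in => k kA.
have [a1 _] := p1; have [a2 _] := p2.
by apply: ler_pM; rewrite ?watched_ge0// ?h1// h2.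
Qed.

Definition minimal (t : R) (i j : E) : R :=
  sup (range (fun n => confined (initial_fset E n) t i j)).

Lemma cvg_minimal t i j : 0 <= t ->
  confined (initial_fset E n) t i j @[n --> \oo] --> minimal t i j.
Proof.
move=> t0; apply: nondecreasing_cvgn.
  by move=> m n mn; apply: confined_mono => //; exact: initial_fset_sub.
by exists (p t i j) => _ [n _ <-]; exact: confined_le.
Qed.

Lemma confined_le_minimal n t i j : 0 <= t ->
  confined (initial_fset E n) t i j <= minimal t i j.
Proof.
move=> t0; apply: sup_ubound; last by exists n.
by exists (p t i j) => _ [m _ <-]; exact: confined_le.
Qed.

Lemma minimal_ge0 t i j : 0 <= t -> 0 <= minimal t i j.
Proof.
by move=> t0; apply: le_trans (confined_le_minimal 0 _ _ t0); exact: confined_ge0.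
Qed.

Lemma minimal_le t i j : 0 <= t -> minimal t i j <= p t i j.
Proof.
move=> t0; apply: ge_sup.
  by exists (confined (initial_fset E 0) t i j), 0%N.
by move=> _ [n _ <-]; exact: confined_le.
Qed.

Lemma minimalD (s t : R) i j : 0 <= s -> 0 <= t ->
  (minimal (s + t) i j)%:E =
  \esum_(k in [set: E]) (minimal s i k * minimal t k j)%:E.
Proof.
move=> s0 t0; have st0 : 0 <= s + t by exact: addr_ge0.
apply/eqP; rewrite eq_le; apply/andP; split; last first.
  apply: esum_le_fset => F; rewrite lee_fin.
  have cv : (\sum_(k <- F) confined (initial_fset E n) s i k *
      confined (initial_fset E n) t k j) @[n --> \oo] -->
      \sum_(k <- F) minimal s i k * minimal t k j.
    apply: cvg_big => //; first exact: add_continuous.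
    by move=> k _; apply: cvgM; exact: cvg_minimal.
  rewrite -(cvg_lim _ cv)//; apply: limr_le.
    by apply/cvg_ex; eexists; exact: cv.
  near=> n; apply: le_trans (confined_le_minimal n _ _ st0).
  rewrite confinedD//.
  - apply: ler_sum_fset; first by near: n; apply: near_sub_initial_fset.
    by move=> k; rewrite mulr_ge0 ?confined_ge0.
  - by near: n; exact: near_in_initial_fset.
  - by near: n; exact: near_in_initial_fset.
have : (0 <= \esum_(k in [set: E]) (minimal s i k * minimal t k j)%:E)%E.
  by apply: esum_ge0 => k _; rewrite lee_fin mulr_ge0 ?minimal_ge0.
case sE: (\esum_(k in _) _) => [r| |]//; move=> _; last by rewrite leey.
rewrite lee_fin -(cvg_lim _ (@cvg_minimal _ i j st0))//.
apply: limr_le; first by apply/cvg_ex; exists (minimal (s + t) i j); exact: cvg_minimal.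
near=> n; rewrite confinedD//; last 2 first.
- by near: n; exact: near_in_initial_fset.
- by near: n; exact: near_in_initial_fset.
rewrite -lee_fin -sE.
apply: le_trans
  (fset_le_esum (fun k => minimal s i k * minimal t k j) (initial_fset E n)).
rewrite lee_fin; apply: ler_sum => k _.
by rewrite ler_pM ?confined_ge0 ?confined_le_minimal.
Unshelve. all: by end_near.
Qed.

(** Keeps only the trajectory that is at [i] at every time of the partition: a product of factors 1
    - a t is at least 1 - a S as long as the factors are nonnegative. The bound does not depend on
    the partition, so it survives the infimum. *)
Lemma watched_diag_ge A i (a d : R) s (S : R) : i \in A -> 0 <= a -> a * d <= 1 ->
  (forall t, 0 <= t <= d -> 1 - a * t <= p t i i) ->
  partition_of S s -> S <= d -> 1 - a * S <= watched p A s i i.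
Proof.
move=> iA a0 ad h; elim: s S => [|t s IH] S.
  by move=> [_ <-] _; rewrite big_nil mulr0 subr0 /= eqxx.
move=> pS Sd; have [t0 ps] := partition_of_consP pS.
have St0 := partition_of_ge0 ps; have [s0 _] := ps.
have aS1 : a * S <= 1 by apply: le_trans ad; rewrite ler_wpM2l.
have IH' : 1 - a * (S - t) <= watched p A s i i by apply: IH => //; lra.
have ht : 1 - a * t <= p t i i by apply: h; apply/andP; split => //; lra.
apply: (@le_trans _ _ (p t i i * watched p A s i i)) => /=; last first.
  apply: (ler_sum_at (F := fun k => p t i k * watched p A s k i)) => // k.
  by rewrite mulr_ge0 ?p_ge0 ?watched_ge0.
have aS' : a * (S - t) <= 1 by apply: le_trans aS1; rewrite ler_wpM2l//; lra.
have at1 : a * t <= 1 by apply: le_trans aS1; rewrite ler_wpM2l//; lra.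
apply: (@le_trans _ _ ((1 - a * t) * (1 - a * (S - t)))).
  have := mulr_ge0 (mulr_ge0 a0 t0) (mulr_ge0 a0 St0); nra.
by apply: ler_pM => //; rewrite subr_ge0.
Qed.

(** Keeps only the trajectories that wait at [i], pass to [j] within one block and then wait at [j].
    The first block either waits, which is the induction hypothesis, or makes the passage, which is
    followed by [watched_diag_ge] at [j]. *)
Lemma watched_offdiag_ge A i j (a b d : R) s (S : R) : i \in A -> j \in A -> i != j ->
  0 <= a -> 0 <= b -> a * d <= 1 ->
  (forall t, 0 <= t <= d -> 1 - a * t <= p t i i) ->
  (forall t, 0 <= t <= d -> 1 - a * t <= p t j j) ->
  (forall t, 0 <= t <= d -> b * t <= p t i j) ->
  partition_of S s -> S <= d -> b * S * (1 - a * S) <= watched p A s i j.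
Proof.
move=> iA jA ij a0 b0 ad hi hj hb; elim: s S => [|t s IH] S.
  by move=> [_ <-] _; rewrite big_nil mulr0 mul0r ler0n.
move=> pS Sd; have [t0 ps] := partition_of_consP pS.
have St0 := partition_of_ge0 ps; have [s0 _] := ps.
have aS1 : a * S <= 1 by apply: le_trans ad; rewrite ler_wpM2l.
have Std : S - t <= d by lra.
have tI : 0 <= t <= d by apply/andP; split => //; lra.
have IH' : b * (S - t) * (1 - a * (S - t)) <= watched p A s i j by exact: IH.
have jj := watched_diag_ge jA a0 ad hj ps Std.
apply: (@le_trans _ _
  (p t i i * watched p A s i j + p t i j * watched p A s j j)) => /=; last first.
  apply: (ler_sum_at2 (F := fun k => p t i k * watched p A s k j)) => // k.
  by rewrite mulr_ge0 ?p_ge0 ?watched_ge0.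
have aS' : a * (S - t) <= 1 by apply: le_trans aS1; rewrite ler_wpM2l//; lra.
have at1 : a * t <= 1 by apply: le_trans aS1; rewrite ler_wpM2l//; lra.
apply: (@le_trans _ _ ((1 - a * t) * (b * (S - t) * (1 - a * (S - t))) +
    b * t * (1 - a * (S - t)))).
  rewrite -subr_ge0.
  have -> : (1 - a * t) * (b * (S - t) * (1 - a * (S - t))) +
     b * t * (1 - a * (S - t)) - b * S * (1 - a * S) =
     b * a * t * (t + a * (S - t) * (S - t)) by ring.
  by rewrite !mulr_ge0// addr_ge0// !mulr_ge0.
have c0 : 0 <= 1 - a * (S - t) by rewrite subr_ge0.
apply: lerD; apply: ler_pM => //; rewrite ?subr_ge0 ?hi ?hb// !mulr_ge0//.
Qed.

End Minimal.

Section Qprocess_projections.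
Context {R : realType} {E : countType} (q : E -> E -> R) (p : R -> E -> E -> R).
Hypothesis hp : Qprocess q p.

Lemma Qprocess_ge0 (t : R) i j : 0 <= t -> 0 <= p t i j.
Proof. by case: hp => h *; exact: h. Qed.

Lemma Qprocess0 i j : p 0 i j = (i == j)%:R.
Proof. by case: hp. Qed.

Lemma Qprocess_ck (s t : R) i j : 0 <= s -> 0 <= t ->
  (p (s + t) i j)%:E = \esum_(k in [set: E]) (p s i k * p t k j)%:E.
Proof. by case: hp => _ _ _ h _; exact: h. Qed.

End Qprocess_projections.

(** * The minimal process has the same derivatives at 0 *)

Section Regular.
Context {R : realType} {E : countType} (q : E -> E -> R) (p : R -> E -> E -> R).
Hypothesis hQ : Qmatrix q.
Hypothesis hp : Qprocess q p.

Let p_ge0 := Qprocess_ge0 hp.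
Let p_id := Qprocess0 hp.
Let p_ck := Qprocess_ck hp.

Lemma Qmatrix_diag_le0 i : q i i <= 0.
Proof.
case: hQ => q0 qi; rewrite -oppr_ge0 -lee_fin -qi; apply: esum_ge0 => j /= ji.
by rewrite lee_fin q0// eq_sym.
Qed.

Lemma Qprocess_expand i j (e : R) : 0 < e -> exists2 d, 0 < d &
  forall t : R, 0 <= t <= d -> `|p t i j - (i == j)%:R - q i j * t| <= e * t.
Proof.
move=> e0; case: hp => _ _ _ _ /(_ i j) /cvgrPdist_le /(_ e e0)[d /= d0 hd].
exists (d / 2); first by rewrite divr_gt0.
move=> t /andP[]; rewrite le_eqVlt => /orP[/eqP <- _|t0 td].
  by rewrite p_id !mulr0 subr0 subrr normr0.
have /= := hd t; rewrite sub0r normrN ger0_norm; last exact: ltW.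
move=> /(_ _ t0) h; have {h} : `|q i j - (p t i j - (i == j)%:R) / t| <= e.
  by apply: h; rewrite (le_lt_trans td)// ltr_pdivrMr// ltr_pMr// ltr1n.
rewrite -(ler_pM2r t0) -[X in _ * X <= _](ger0_norm (ltW t0)) -normrM mulrBl.
by rewrite divfK ?gt_eqF// distrC.
Qed.

Lemma cvg_of_expand (f : R -> R) (c l : R) :
  (forall e, 0 < e -> exists2 d, 0 < d &
     forall t : R, 0 <= t <= d -> `|f t - c - l * t| <= e * t) ->
  (f t - c) / t @[t --> 0^'+] --> l.
Proof.
move=> h; apply/cvgrPdist_le => e e0; have [d d0 hd] := h e e0.
exists d => //= t; rewrite /ball/= sub0r normrN => td t0.
rewrite -(ler_pM2r t0) -[X in _ * X <= _](ger0_norm (ltW t0)) -normrM mulrBl.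
rewrite divfK ?gt_eqF// distrC; apply: hd; rewrite ltW//=.
by rewrite (le_trans (ler_norm _))// ltW.
Qed.

Lemma diag_lower i (a : R) : - q i i < a -> exists2 d, 0 < d &
  forall t : R, 0 <= t <= d -> 1 - a * t <= p t i i.
Proof.
move=> qa; have [|d d0 hd] := Qprocess_expand i i (e := a + q i i); first lra.
exists d => // t td; have := hd t td; rewrite eqxx/= ler_norml => /andP[h _].
by move: h; rewrite mulrDl; lra.
Qed.

(** Upper bounds come from domination by [p]. Only the lower bounds on the derivatives at 0 need
    work; they are the estimates above, uniform over partitions, on a finite set that contains both
    states. *)
Lemma Qprocess_minimal : Qprocess q (minimal p).
Proof.
split.
- by move=> t i j; exact: minimal_ge0.
- move=> t i t0; case: hp => _ /(_ t i t0) h _ _ _; apply: le_trans h.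
  by apply: le_esum => j _; rewrite lee_fin; exact: minimal_le.
- move=> i j; apply/eqP; rewrite eq_le; apply/andP; split.
    by rewrite -p_id; apply: minimal_le.
  pose A := initial_fset E (choice.pickle i).+1.
  apply: le_trans (confined_le_minimal p_ge0 p_id p_ck (choice.pickle i).+1 _ _ (lexx 0)).
  apply: le_confined => // s ps; rewrite (watched0 p_id _ _ ps)//.
  by rewrite in_initial_fset.
- exact: minimalD.
move=> i j; apply: cvg_of_expand => e e0.
pose n := (maxn (choice.pickle i) (choice.pickle j)).+1.
have iA : i \in initial_fset E n by rewrite in_initial_fset ltnS leq_maxl.
have jA : j \in initial_fset E n by rewrite in_initial_fset ltnS leq_maxr.
have [d1 d10 hd1] := Qprocess_expand i j e0.
(* Exceeds both exit rates, since the diagonal entries are nonpositive. *)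
pose a := 1 + e - q i i - q j j.
have qi0 := Qmatrix_diag_le0 i; have qj0 := Qmatrix_diag_le0 j.
have upper t : 0 <= t <= d1 -> minimal p t i j - (i == j)%:R - q i j * t <= e * t.
  move=> td; have /andP[t0 _] := td.
  have := hd1 t td; rewrite ler_norml => /andP[_].
  by have := minimal_le p_ge0 p_id p_ck i j t0; lra.
have [ij|ij] := eqVneq i j.
  subst j; have [|d2 d20 hd2] := @diag_lower i (e - q i i); first lra.
  have a0 : 0 < e - q i i by lra.
  exists (Num.min d1 (Num.min d2 (e - q i i)^-1)).
    by rewrite !lt_min d10 d20 invr_gt0.
  move=> t /andP[t0]; rewrite !le_min => /and3P[td1 td2 td3].
  rewrite ler_norml; apply/andP; split; last first.
    by have := upper t; rewrite eqxx/=; apply; rewrite t0.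
  rewrite /=; suff : 1 - (e - q i i) * t <= minimal p t i i by rewrite mulrBl; lra.
  apply: le_trans (confined_le_minimal p_ge0 p_id p_ck n _ _ t0).
  apply: le_confined => // s ps.
  apply: (watched_diag_ge p_ge0 iA (d := t)) => //.
  - exact: ltW.
  - by rewrite mulrC -ler_pdivlMr// div1r.
  - by move=> u /andP[u0 ut]; apply: hd2; rewrite u0 (le_trans ut).
have qij0 : 0 <= q i j by case: hQ => h _; exact: h.
have [d2 d20 hd2] := @diag_lower i a ltac:(rewrite /a; lra).
have [d3 d30 hd3] := @diag_lower j a ltac:(rewrite /a; lra).
have e20 : 0 < e / 2 by rewrite divr_gt0.
have [d4 d40 hd4] := Qprocess_expand i j e20.
have a0 : 0 < a by rewrite /a; lra.
(* Cut off at 0 because [watched_offdiag_ge] wants a nonnegative slope and q_ij may be smaller than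
   e/2. *)
pose b := Num.max 0 (q i j - e / 2).
have b0 : 0 <= b by rewrite le_max lexx.
have bq : q i j - e / 2 <= b by rewrite le_max lexx orbT.
have ba0 : 0 <= b * a by rewrite mulr_ge0// ltW.
have ba1 : 0 < 1 + b * a by lra.
(* The last bound keeps the quadratic loss b a t^2 below (e/2) t; the 1 added to b a avoids division
   by 0. *)
exists (Num.min d1 (Num.min (Num.min d2 d3) (Num.min d4
    (Num.min a^-1 (e / 2 / (1 + b * a)))))).
  by rewrite !lt_min d10 d20 d30 d40 invr_gt0 a0 divr_gt0.
move=> t /andP[t0]; rewrite !le_min.
move=> /andP[td1 /andP[/andP[td2 td3] /and3P[td4 ta tb]]].
rewrite ler_norml; apply/andP; split; last first.
  by have := upper t; rewrite (negPf ij); apply; rewrite t0.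
rewrite /= subr0.
suff le : b * t * (1 - a * t) <= minimal p t i j.
  have bat : b * a * t <= e / 2.
    move: tb; rewrite ler_pdivlMr// => h; apply: le_trans h.
    rewrite -subr_ge0.
    by have -> : t * (1 + b * a) - b * a * t = t by ring.
  have : b * a * t * t <= e / 2 * t by rewrite ler_wpM2r.
  have : (q i j - e / 2) * t <= b * t by rewrite ler_wpM2r.
  have e1 : b * t * (1 - a * t) = b * t - b * a * t * t by ring.
  by move: le; rewrite e1 mulrBl; lra.
apply: le_trans (confined_le_minimal p_ge0 p_id p_ck n _ _ t0).
apply: le_confined => // s ps.
apply: (watched_offdiag_ge p_ge0 iA jA ij (d := t)) => //.
- exact: ltW.
- by rewrite mulrC -ler_pdivlMr// div1r.
- by move=> u /andP[u0 ut]; apply: hd2; rewrite u0 (le_trans ut).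
- by move=> u /andP[u0 ut]; apply: hd3; rewrite u0 (le_trans ut).
- move=> u /andP[u0 ut].
  rewrite /b; have [le0|_] := leP 0 (q i j - e / 2); last by rewrite mul0r p_ge0.
  have := hd4 u; rewrite u0 (le_trans ut)// (negPf ij) => /(_ isT).
  by rewrite ler_norml => /andP[h _]; rewrite mulrBl; move: h; rewrite subr0; lra.
Qed.

Hypothesis hreg : Qregular q.

Lemma regular_minimal t i j : 0 <= t -> minimal p t i j = p t i j.
Proof.
move=> t0; case: hreg => p0 [_ _ h].
by rewrite (h _ Qprocess_minimal)// (h _ hp).
Qed.

Lemma regular_honest : honest p.
Proof.
case: hreg => p0 [_ p0h h] t i t0; rewrite -(p0h t i t0).
by apply: eq_esum => j _; rewrite (h _ hp).
Qed.

Lemma cvg_confined t i j : 0 <= t ->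
  confined p (initial_fset E n) t i j @[n --> \oo] --> p t i j.
Proof. by move=> t0; rewrite -(regular_minimal _ _ t0); exact: cvg_minimal. Qed.

End Regular.

(** * Foster's criterion *)

Section Drift.
Context {R : realType} {E : countType} (q : E -> E -> R) (p : R -> E -> E -> R).
Hypothesis hQ : Qmatrix q.
Hypothesis hp : Qprocess q p.

Let p_ge0 := Qprocess_ge0 hp.
Let p_id := Qprocess0 hp.
Let p_ck := Qprocess_ck hp.

Lemma Qprocess_ck_ge (s t : R) i k j : 0 <= s -> 0 <= t ->
  p s i k * p t k j <= p (s + t) i j.
Proof.
move=> s0 t0; rewrite -lee_fin p_ck//.
apply: (@le_esum_at _ _ (fun k => (p s i k * p t k j)%:E)) => l.
by rewrite lee_fin mulr_ge0 ?p_ge0.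
Qed.

Lemma Qprocess_expr_le (t : R) i n : 0 <= t -> p t i i ^+ n <= p (t *+ n) i i.
Proof.
move=> t0; elim: n => [|n IH]; first by rewrite mulr0n expr0 p_id eqxx.
rewrite exprS mulrS; apply: le_trans (Qprocess_ck_ge _ i _ _ _) => //.
  by rewrite ler_wpM2l ?p_ge0.
by rewrite mulrn_wge0.
Qed.

(** Divide [0, t] into n+1 pieces of length below 1/(2a). On each piece p_ii is at least 1/2, whence
    c = 2^-(n+1). *)
Lemma Qprocess_diag_lbound i : exists2 c, 0 < c &
  forall t : R, 0 <= t <= 1 -> c <= p t i i.
Proof.
have qi := Qmatrix_diag_le0 hQ i.
pose a := 1 - q i i.
have a0 : 0 < a by rewrite /a; lra.
have [|d d0 hd] := diag_lower hp (i := i) (a := a); first by rewrite /a; lra.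
have [n hn] : exists n, n.+1%:R^-1 < Num.min d (a^-1 / 2).
  have m0 : 0 < Num.min d (a^-1 / 2) by rewrite lt_min d0 divr_gt0 ?invr_gt0.
  by have [n] := ltr_add_invr m0; rewrite add0r => h; exists n.
exists ((2^-1) ^+ n.+1) => [|t /andP[t0 t1]]; first by rewrite exprn_gt0.
have n0 : (0 : R) < n.+1%:R by [].
have tn0 : 0 <= t / n.+1%:R by rewrite divr_ge0.
have -> : t = (t / n.+1%:R) *+ n.+1.
  by rewrite -mulr_natr divfK// gt_eqF.
apply: le_trans (Qprocess_expr_le _ _ tn0).
have tn1 : t / n.+1%:R <= n.+1%:R^-1 by rewrite ler_piMl// invr_ge0 ltW.
move: hn; rewrite lt_min => /andP[hn1 hn2].
apply: lerXn2r; rewrite ?nnegrE ?p_ge0//.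
apply: le_trans (hd _ _); last by rewrite tn0 (le_trans tn1)// ltW.
have : a * (t / n.+1%:R) <= a * (a^-1 / 2).
  by rewrite ler_wpM2l ?(ltW a0)// (le_trans tn1)// ltW.
rewrite (mulrA a a^-1) divff ?gt_eqF//; move: (a * (t / _)) => x; lra.
Qed.

Lemma Qprocess_edge_gt0 i j (t : R) : 0 < q i j -> 0 < t <= 1 -> 0 < p t i j.
Proof.
move=> qij /andP[t0 t1].
have ij : i != j.
  apply: contraTneq qij => ->; rewrite -leNgt; exact: Qmatrix_diag_le0.
have q20 : 0 < q i j / 2 by rewrite divr_gt0.
have [d d0 hd] := Qprocess_expand hp i j q20.
have m0 : 0 < Num.min d t by rewrite lt_min d0.
have mt : 0 <= t - Num.min d t by rewrite subr_ge0 ge_min lexx orbT.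
have : 0 < p (Num.min d t) i j.
  have := hd (Num.min d t); rewrite (ltW m0) ge_min lexx => /(_ isT).
  rewrite (negPf ij) subr0 ler_norml => /andP[h _].
  have : 0 < q i j / 2 * Num.min d t by rewrite mulr_gt0.
  by lra.
move=> pm; have [c c0 hc] := Qprocess_diag_lbound j.
have -> : t = Num.min d t + (t - Num.min d t) by rewrite addrC subrK.
apply: lt_le_trans (Qprocess_ck_ge i j j (ltW m0) mt).
rewrite mulr_gt0//; apply: lt_le_trans c0 _; apply: hc; rewrite mt/=.
by move: (ltW m0); lra.
Qed.

(** Each edge of a path from [i] to [j] uses half of the remaining time; the induction is therefore
    over all t in (0, 1]. *)
Lemma Qprocess_gt0 (hirr : Qirreducible q) i j : 0 < p 1 i j.
Proof.
have [s [qs <-]] := hirr i j.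
suff h : forall t : R, 0 < t <= 1 -> 0 < p t i (last i s).
  by apply: h; rewrite ltr01 lexx.
elim: s i qs => [|k s IH] i /=.
  move=> _ t /andP[t0 t1]; have [c c0 hc] := Qprocess_diag_lbound i.
  by apply: lt_le_trans c0 _; apply: hc; rewrite t1 andbT ltW.
move=> /andP[qik qs] t /andP[t0 t1].
have t20 : 0 < t / 2 by rewrite divr_gt0.
rewrite (splitr t).
apply: lt_le_trans (Qprocess_ck_ge i k _ (ltW t20) (ltW t20)).
rewrite mulr_gt0 ?IH ?Qprocess_edge_gt0 ?t20//=; lra.
Qed.

Lemma Qprocess_expand_unif (l : seq (E * E)) (e : R) : 0 < e -> exists2 d, 0 < d &
  forall x, x \in l -> forall t : R, 0 <= t <= d ->
    p t x.1 x.2 <= (x.1 == x.2)%:R + (q x.1 x.2 + e) * t.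
Proof.
move=> e0; elim: l => [|x l [d d0 hd]]; first by exists 1.
have [d1 d10 hd1] := Qprocess_expand hp x.1 x.2 e0.
exists (Num.min d d1) => [|y yl t]; first by rewrite lt_min d0.
rewrite le_min => /and3P[t0 td td1].
move: yl; rewrite inE => /orP[/eqP ->|yl]; last by apply: hd => //; rewrite t0.
have := hd1 t; rewrite t0 td1 ler_norml => /(_ isT)/andP[_].
by rewrite mulrDl; lra.
Qed.

Lemma Qprocess_drift (A : {fset E}) (V g : E -> R) (e : R) :
  (forall i, 0 <= V i) -> 0 < e ->
  (forall i, i \in A -> \sum_(j <- A) q i j * V j <= g i) ->
  exists2 d, 0 < d & forall h : R, 0 <= h <= d -> forall i, i \in A ->
    \sum_(j <- A) p h i j * V j <= V i + h * (g i + e).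
Proof.
move=> V0 e0 hg; pose S := \sum_(j <- A) V j.
have S0 : 0 <= S by apply: sumr_ge0.
have S10 : 0 < 1 + S by lra.
(* The tolerance per entry: weighted by V over A it adds up to at most e, also when S = 0. *)
have e'0 : 0 < e / (1 + S) by rewrite divr_gt0.
have [d d0 hd] := Qprocess_expand_unif [seq (i, j) | i <- A, j <- A] e'0.
exists d => // h hI i iA; have /andP[h0 _] := hI.
have -> : V i = \sum_(j <- A) (i == j)%:R * V j by rewrite sum_delta.
apply: (@le_trans _ _ (\sum_(j <- A) (((i == j)%:R * V j + h * (q i j * V j))
    + h * (e / (1 + S)) * V j))).
  apply: ler_sum_in => j jA.
  have -> : (i == j)%:R * V j + h * (q i j * V j) + h * (e / (1 + S)) * V j =
      ((i == j)%:R + (q i j + e / (1 + S)) * h) * V j by ring.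
  rewrite ler_wpM2r//; apply: (hd (i, j)) => //.
  by apply/allpairsP; exists (i, j).
rewrite !big_split/= -addrA lerD2l -!mulr_sumr -/S -mulrA -mulrDr.
rewrite ler_wpM2l// lerD// ?hg//.
by rewrite mulrAC -mulrA ler_piMr// ?(ltW e0)// ler_pdivrMr// mul1r; lra.
Qed.

Lemma watched_seq1 (A : {fset E}) (h : R) i j : j \in A ->
  watched p A [:: h] i j = p h i j.
Proof.
move=> jA /=; under eq_bigr do rewrite eq_sym mulrC.
by rewrite (sum_delta _ jA).
Qed.

(** A discrete Dynkin formula for the chain with step [h] killed outside A. *)
Lemma watched_drift (A : {fset E}) (V g : E -> R) (h : R) n i :
  0 <= h ->
  (forall i, i \in A -> \sum_(j <- A) p h i j * V j <= V i + h * g i) ->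
  i \in A ->
  \sum_(j <- A) watched p A (nseq n h) i j * V j <= V i +
    h * \sum_(m < n) \sum_(j <- A) watched p A (nseq m h) i j * g j.
Proof.
move=> h0 step iA; elim: n => [|n IH].
  by rewrite big_ord0 mulr0 addr0 /= sum_delta.
have -> : \sum_(j <- A) watched p A (nseq n.+1 h) i j * V j =
    \sum_(k <- A) watched p A (nseq n h) i k * \sum_(j <- A) p h k j * V j.
  rewrite big_seq.
  under eq_bigr => j jA.
    rewrite -addn1 nseqD (watched_cat p _ _ _ iA) mulr_suml.
    under eq_bigr do rewrite (watched_seq1 _ _ jA) -mulrA.
    over.
  rewrite -big_seq exchange_big/=; apply: eq_bigr => k _.
  by rewrite mulr_sumr.
rewrite big_ord_recr/= mulrDr addrA.
apply: le_trans (lerD IH (lexx _)).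
rewrite mulr_sumr -big_split/=; apply: ler_sum_in => k kA.
rewrite mulrCA -mulrDr ler_wpM2l//; last exact: step.
by apply: watched_ge0 => //; rewrite all_nseq h0 orbT.
Qed.

Lemma sum_Qprocess_le1 (A : {fset E}) (t : R) i : 0 <= t ->
  \sum_(j <- A) p t i j <= 1.
Proof.
move=> t0; case: hp => _ /(_ t i t0) h _ _ _; rewrite -lee_fin.
by apply: le_trans h; exact: fset_le_esum.
Qed.

Lemma partition_of_nseq n (h : R) : 0 <= h -> partition_of (h *+ n) (nseq n h).
Proof.
move=> h0; split; first by rewrite all_nseq h0 orbT.
by elim: n => [|n IH]; rewrite ?big_nil ?mulr0n//= big_cons IH mulrS.
Qed.

Lemma watched_mass_decr (A : {fset E}) (s r : seq R) i : i \in A ->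
  all (>= 0) s -> all (>= 0) r ->
  \sum_(j <- A) watched p A (s ++ r) i j <= \sum_(j <- A) watched p A s i j.
Proof.
move=> iA s0 r0; under eq_bigr do rewrite (watched_cat p _ _ _ iA).
rewrite exchange_big/=; apply: ler_sum => k _.
rewrite -mulr_sumr ler_piMr ?watched_ge0//.
have pr : partition_of (\sum_(x <- r) x) r by split.
apply: le_trans (sum_Qprocess_le1 A k (partition_of_ge0 pr)).
by apply: ler_sum => j _; exact: (watched_le p_ge0 p_id p_ck).
Qed.

Lemma Qprocess_lbound_unif (H : seq E) : exists2 c, 0 < c &
  forall j, j \in H -> forall t : R, 0 <= t <= 1 -> c <= p t j j.
Proof.
elim: H => [|j H [c c0 hc]]; first by exists 1.
have [c1 c10 hc1] := Qprocess_diag_lbound j.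
exists (Num.min c c1) => [|k kH t tI]; first by rewrite lt_min c0.
move: kH; rewrite inE => /orP[/eqP ->|kH]; rewrite ge_min ?hc1 ?orbT//.
by rewrite hc.
Qed.

(** The unit interval is cut into n+1 steps, short enough for the expansion of p(h) on A. Passing
    from [watched] to [confined] is legitimate on the left, where V is nonnegative; on the right [g]
    may change sign, so [watched] stays. *)
Lemma confined_drift (A : {fset E}) (V g : E -> R) (e : R) i :
  (forall i, 0 <= V i) -> 0 < e ->
  (forall i, i \in A -> \sum_(j <- A) q i j * V j <= g i) -> i \in A ->
  exists n, \sum_(j <- A) confined p A 1 i j * V j <= V i + n.+1%:R^-1 *
    \sum_(m < n.+1) \sum_(j <- A) watched p A (nseq m n.+1%:R^-1) i j * (g j + e).
Proof.
move=> V0 e0 hg iA; have [d d0 hd] := Qprocess_drift V0 e0 hg.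
have [n] := ltr_add_invr d0; rewrite add0r => hn; exists n.
have n0 : (0 : R) < n.+1%:R by [].
have h0 : (0 : R) <= n.+1%:R^-1 by rewrite invr_ge0 ltW.
apply: le_trans (watched_drift n.+1 (g := fun j => g j + e) h0 _ iA); last first.
  by apply: hd; rewrite h0 ltW.
apply: ler_sum => j _; rewrite ler_wpM2r//.
apply: confined_le_watched => //.
have := partition_of_nseq n.+1 h0.
by rewrite -[_ *+ n.+1]mulr_natr mulVf ?gt_eqF.
Qed.

Hypothesis hreg : Qregular q.

Lemma drift_skeleton (H : {fset E}) (V : E -> R) (C : R) :
  (forall i, 0 <= V i) -> 0 <= C ->
  (forall (A : {fset E}) i, i \in A ->
    \sum_(j <- A) q i j * V j <= -1 + C * (i \in H)%:R) ->
  exists2 C', 0 < C' & forall i,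
    (\esum_(j in [set: E]) (p 1 i j * V j)%:E + 1 <=
      (V i + C' * \sum_(j <- H) p 1 i j)%:E)%E.
Proof.
move=> V0 C0 hV; have [c c0 hc] := Qprocess_lbound_unif H.
(* C / c is the constant that is needed; adding 1 makes it positive even if C = 0. *)
exists (C / c + 1) => [|i]; first by rewrite ltr_wpDl// divr_ge0// ltW.
pose B := V i + (C / c + 1) * \sum_(j <- H) p 1 i j.
have h01 : (0 : R) <= 1 by [].
(* The killed chain loses mass, so on a finite A the gain is only the surviving mass M. It is
   carried inside V + 1 and becomes 1 in the limit because [p] is honest. *)
have fin (A : {fset E}) : i \in A -> \sum_(j <- A) confined p A 1 i j * (V j + 1) <= B.
  move=> iA; apply/ler_addgt0Pr => e e0.
  have [n hn] := confined_drift V0 e0 (hV A) iA.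
  have n0 : (0 : R) < n.+1%:R by [].
  have h0 : (0 : R) <= n.+1%:R^-1 by rewrite invr_ge0 ltW.
  pose M := \sum_(j <- A) confined p A 1 i j.
  have step (m : 'I_n.+1) :
      \sum_(j <- A) watched p A (nseq m n.+1%:R^-1) i j *
        (-1 + C * (j \in H)%:R + e) <=
      e - M + C / c * \sum_(j <- H) p 1 i j.
    pose w := watched p A (nseq m n.+1%:R^-1) i.
    have pw := partition_of_nseq m h0.
    have w0 j : 0 <= w j by apply: watched_ge0 => //; case: pw.
    have m0 : 0 <= n.+1%:R^-1 *+ m :> R by exact: partition_of_ge0 pw.
    have m1 : n.+1%:R^-1 *+ m <= 1 :> R.
      rewrite -[leLHS]mulr_natr mulrC ler_pdivrMr// mul1r ler_nat; exact: ltnW.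
    (* Mass only decreases in time, so at each intermediate step the drift -1 acts on at least the
       final mass. *)
    have wM : M <= \sum_(j <- A) w j.
      have all0 k : all (>= 0) (nseq k (n.+1%:R^-1 : R)) by rewrite all_nseq h0 orbT.
      have := watched_mass_decr iA (all0 m) (all0 (n.+1 - m)%N).
      rewrite -nseqD subnKC; last exact: ltnW.
      apply: le_trans; apply: ler_sum => j _; apply: confined_le_watched => //.
      have := partition_of_nseq n.+1 h0.
      by rewrite -[_ *+ n.+1]mulr_natr mulVf ?gt_eqF.
    have w1 : \sum_(j <- A) w j <= 1.
      apply: le_trans (sum_Qprocess_le1 A i m0); apply: ler_sum => j _.
      exact: (watched_le p_ge0 p_id p_ck).
    (* Being at j in H at time m h and again at time 1 has probability at least c times the weight
       of [j]; this converts time spent in H into p(1). *)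
    have wH : \sum_(j <- A) w j * (j \in H)%:R <= c^-1 * \sum_(j <- H) p 1 i j.
      apply: (@le_trans _ _ (\sum_(j <- H) w j)).
        under eq_bigr do rewrite mulr_natr mulrb.
        rewrite -big_mkcond/= -big_filter.
        have -> : \sum_(j <- [seq j <- A | j \in H]) w j =
            \sum_(j <- [fset j in A | j \in H]%fset) w j.
          apply: perm_big; apply: uniq_perm; rewrite ?filter_uniq ?fset_uniq//.
          by move=> j; rewrite mem_filter !inE andbC.
        by apply: ler_sum_fset => // j; rewrite !inE => /andP[].
      rewrite mulr_sumr; apply: ler_sum_in => j jH.
      rewrite mulrC ler_pdivlMr//.
      have m10 : 0 <= 1 - n.+1%:R^-1 *+ m :> R by rewrite subr_ge0.
      have -> : (1 : R) = n.+1%:R^-1 *+ m + (1 - n.+1%:R^-1 *+ m).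
        by rewrite addrC subrK.
      apply: le_trans (Qprocess_ck_ge i j j m0 m10).
      apply: ler_pM => //; first exact: ltW.
        exact: (watched_le p_ge0 p_id p_ck).
      by apply: hc => //; rewrite m10 gerBl.
    have -> : \sum_(j <- A) watched p A (nseq m n.+1%:R^-1) i j *
        (-1 + C * (j \in H)%:R + e) =
        (e - 1) * \sum_(j <- A) w j + C * \sum_(j <- A) w j * (j \in H)%:R.
      rewrite !mulr_sumr -big_split/=; apply: eq_bigr => j _; rewrite -/(w j).
      by ring.
    have : C * (\sum_(j <- A) w j * (j \in H)%:R) <= C * (c^-1 * \sum_(j <- H) p 1 i j).
      by rewrite ler_wpM2l.
    rewrite mulrA => h1; rewrite lerD//.
    have : e * \sum_(j <- A) w j <= e * 1 by rewrite ler_wpM2l// ltW.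
    by rewrite mulrBl mul1r mulr1; lra.
  have : n.+1%:R^-1 * \sum_(m < n.+1) \sum_(j <- A)
      watched p A (nseq m n.+1%:R^-1) i j * (-1 + C * (j \in H)%:R + e) <=
      e - M + C / c * \sum_(j <- H) p 1 i j.
    apply: (@le_trans _ _ (n.+1%:R^-1 * \sum_(m < n.+1)
        (e - M + C / c * \sum_(j <- H) p 1 i j))).
      by rewrite ler_wpM2l// ler_sum.
    by rewrite sumr_const card_ord -[X in _ * X <= _]mulr_natr mulrC mulfK// gt_eqF.
  have -> : \sum_(j <- A) confined p A 1 i j * (V j + 1) =
      \sum_(j <- A) confined p A 1 i j * V j + M.
    by rewrite -big_split/=; apply: eq_bigr => j _; rewrite mulrDr mulr1.
  have : 0 <= \sum_(j <- H) p 1 i j by apply: sumr_ge0 => j _; exact: p_ge0.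
  rewrite /B mulrDl mul1r; move: hn.
  set x := n.+1%:R^-1 * _; set S := \sum_(j <- H) _; set cS := C / c * _.
  by set y := \sum_(j <- A) _; move: x S cS y (M) => x S cS y m; lra.
have -> : (\esum_(j in [set: E]) (p 1 i j * V j)%:E + 1 =
    \esum_(j in [set: E]) (p 1 i j * (V j + 1))%:E)%E.
  rewrite -(regular_honest hp hreg i h01) -esumDr.
  - by apply: eq_esum => j _; rewrite mulrDr mulr1.
  - by move=> j; rewrite mulr_ge0 ?p_ge0.
  - by move=> j; exact: p_ge0.
apply: esum_le_fset => F; rewrite lee_fin -/B.
have cv : (\sum_(j <- F) confined p (initial_fset E n) 1 i j * (V j + 1))
    @[n --> \oo] --> \sum_(j <- F) p 1 i j * (V j + 1).
  apply: cvg_big => //; first exact: add_continuous.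
  by move=> j _; apply: cvgMl; exact: (cvg_confined hQ hp hreg).
rewrite -(cvg_lim _ cv)//; apply: limr_le.
  by apply/cvg_ex; eexists; exact: cv.
near=> n; apply: le_trans (fin (initial_fset E n) _).
  apply: ler_sum_fset; first by near: n; exact: near_sub_initial_fset.
  by move=> j; rewrite mulr_ge0 ?confined_ge0 ?addr_ge0.
by near: n; exact: near_in_initial_fset.
Unshelve. all: by end_near.
Qed.

End Drift.

(** Replaces a diagonal extraction of subsequences: a single ultrafilter serves for all states
    simultaneously. *)
Lemma ultra_cvg (R : realType) (U : set_system nat) (f : nat -> R) (a b : R) :
  UltraFilter U -> (forall n, a <= f n <= b) ->
  exists l : R, f n @[n --> U] --> l.
Proof.
move=> UU fab.
have UfU : UltraFilter (fmap f U).
  split; first exact: fmap_proper_filter.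
  move=> G PG UG; apply/seteqP; split; last exact: UG.
  move=> B GB; have [//|UnB] := in_ultra_setVsetC (f @^-1` B) UU.
  have GnB : G (~` B) by exact: UG.
  have := filterI GB GnB; rewrite setICr => G0.
  by case: (@filter_not_empty _ G _ (G0 _)).
have := @segment_compact R a b; rewrite compact_ultra => /(_ _ UfU).
move=> [|l [_ ?]]; last by exists l.
change (U (f @^-1` `[a, b])); apply: filterE => n /=.
by rewrite in_itv/= fab.
Qed.

(** * A drift condition yields a stationary distribution *)

Section Foster.
Context {R : realType} {E : countType} (q : E -> E -> R) (p : R -> E -> E -> R).
Hypothesis hQ : Qmatrix q.
Hypothesis hirr : Qirreducible q.
Hypothesis hreg : Qregular q.
Hypothesis hp : Qprocess q p.

Let p_ge0 := Qprocess_ge0 hp.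
Let p_id := Qprocess0 hp.
Let p_ck := Qprocess_ck hp.

Let p_honest : honest p := regular_honest hp hreg.

(** Applying p(n) to the one-step inequality gains 1 at each time, by honesty. The induction carries
    the finite value a = (p(n)V)_i and drops it at the end, as it is nonnegative. *)
Lemma drift_iter (H : {fset E}) (V : E -> R) (C : R) i :
  (forall i, 0 <= V i) ->
  (forall i, (\esum_(j in [set: E]) (p 1 i j * V j)%:E + 1 <=
    (V i + C * \sum_(j <- H) p 1 i j)%:E)%E) ->
  0 < C ->
  forall n, n%:R <= V i + C * \sum_(k < n) \sum_(j <- H) p k.+1%:R i j.
Proof.
move=> V0 hV C0 n.
suff [a [a0 _ h]] : exists a, [/\ 0 <= a,
    \esum_(j in [set: E]) (p n%:R i j * V j)%:E = a%:E &
    a + n%:R <= V i + C * \sum_(k < n) \sum_(j <- H) p k.+1%:R i j].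
  by move: h; lra.
elim: n => [|n [a [a0 ae h]]].
  exists (V i); split => //; last by rewrite addr0 big_ord0 mulr0 addr0.
  under eq_esum do rewrite p_id mulrC eq_sym.
  exact: esum_delta.
pose PV k := fine (\esum_(j in [set: E]) (p 1 k j * V j)%:E).
have pV0 k j : 0 <= p 1 k j * V j by rewrite mulr_ge0 ?p_ge0.
have PVE k : \esum_(j in [set: E]) (p 1 k j * V j)%:E = (PV k)%:E.
  apply: (@esum_fineK _ _ _ (V k + C * \sum_(j <- H) p 1 k j)) => //.
  by apply: le_trans (hV k); rewrite leeDl.
have PV0 k : 0 <= PV k.
  by rewrite -lee_fin -PVE; apply: esum_ge0 => j _; rewrite lee_fin.
have n0 : (0 : R) <= n%:R by [].
have e : \esum_(k in [set: E]) (p n%:R i k * PV k)%:E =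
    \esum_(j in [set: E]) (p n.+1%:R i j * V j)%:E.
  apply: (esum_assoc (b := p 1)) => //.
  - by move=> k; exact: p_ge0.
  - by move=> k j; exact: p_ge0.
  - by move=> j; rewrite -natr1 p_ck.
have e1 : (\esum_(k in [set: E]) (p n%:R i k * (PV k + 1))%:E =
    \esum_(j in [set: E]) (p n.+1%:R i j * V j)%:E + 1)%E.
  rewrite -e -(p_honest i n0) -esumDr.
  - by apply: eq_esum => k _; rewrite mulrDr mulr1.
  - by move=> k; rewrite mulr_ge0 ?p_ge0.
  - by move=> k; exact: p_ge0.
have e2 : \esum_(k in [set: E])
      (p n%:R i k * (V k + C * \sum_(j <- H) p 1 k j))%:E =
    (a + C * \sum_(j <- H) p n.+1%:R i j)%:E.
  rewrite EFinD -ae EFinM -sumEFin.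
  under [X in (_ + _ * X)%E]eq_bigr => j _ do rewrite -natr1 p_ck//.
  rewrite -esum_sum; last by move=> k j _ _; rewrite lee_fin mulr_ge0 ?p_ge0.
  rewrite -esumZ ?(ltW C0)//; last first.
    move=> k; rewrite sumEFin lee_fin; apply: sumr_ge0 => j _.
    by rewrite mulr_ge0 ?p_ge0.
  rewrite -esumD.
  - apply: eq_esum => k _; rewrite sumEFin -EFinM -EFinD -mulr_sumr.
    by congr EFin; ring.
  - by move=> k _; rewrite lee_fin mulr_ge0 ?p_ge0.
  - move=> k _; rewrite sumEFin -EFinM lee_fin mulr_ge0 ?(ltW C0)//.
    by apply: sumr_ge0 => j _; rewrite mulr_ge0 ?p_ge0.
have le : (\esum_(j in [set: E]) (p n.+1%:R i j * V j)%:E + 1 <=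
    (a + C * \sum_(j <- H) p n.+1%:R i j)%:E)%E.
  rewrite -e1 -e2; apply: le_esum => k _; rewrite lee_fin ler_wpM2l ?p_ge0//.
  by rewrite -lee_fin EFinD -PVE.
have pVn j : 0 <= p n.+1%:R i j * V j by rewrite mulr_ge0 ?p_ge0.
have [|a' ae'] := esum_fin (c := a + C * \sum_(j <- H) p n.+1%:R i j) pVn.
  by apply: le_trans le; rewrite leeDl.
exists a'; split => //.
  by rewrite -lee_fin -ae'; apply: esum_ge0 => j _; rewrite lee_fin.
move: le; rewrite ae' -EFinD lee_fin big_ord_recr/= mulrDr -natr1.
by move: h; set x := C * _; set y := C * _; lra.
Qed.

(* A limit, along an ultrafilter, of the Cesaro means of the rows of p(k+1) is
   subinvariant of finite mass, hence invariant; the drift condition keeps it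
   nonzero. *)
Lemma ergodic_of_skeleton_drift (H : {fset E}) (V : E -> R) (C : R) (i : E) :
  (forall i, 0 <= V i) -> 0 < C ->
  (forall i, (\esum_(j in [set: E]) (p 1 i j * V j)%:E + 1 <=
    (V i + C * \sum_(j <- H) p 1 i j)%:E)%E) ->
  ergodic p.
Proof.
move=> V0 C0 hV.
have hn := drift_iter i V0 hV C0.
pose nu (n : nat) j := @harmonic R n * \sum_(k < n.+1) p k.+1%:R i j.
have har0 n : 0 < @harmonic R n by rewrite invr_gt0.
have harn n : @harmonic R n * n.+1%:R = 1 by rewrite mulVf// gt_eqF.
have nu0 n j : 0 <= nu n j.
  by rewrite mulr_ge0 ?(ltW (har0 _))// sumr_ge0// => k _; rewrite p_ge0.
have nuF n (F : {fset E}) : \sum_(j <- F) nu n j <= 1.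
  rewrite -mulr_sumr exchange_big/= -[leRHS](harn n) ler_wpM2l ?(ltW (har0 _))//.
  have -> : n.+1%:R = \sum_(k < n.+1) (1 : R) by rewrite sumr_const card_ord.
  apply: ler_sum => k _.
  exact: (sum_Qprocess_le1 hp).
have nu1 n j : 0 <= nu n j <= 1.
  by rewrite nu0/=; have := nuF n [fset j]%fset; rewrite big_seq_fset1.
have [U [UU oU]] := @ultraFilterLemma _ (\oo : set_system nat) _.
have PU : ProperFilter U by exact: ultra_proper.
have /choice[mu mucvg] : forall j, exists l : R, nu n j @[n --> U] --> l.
  by move=> j; exact: (ultra_cvg UU (fun n => nu1 n j)).
have cvgU (f : nat -> R) (l : R) : f n @[n --> \oo] --> l -> f n @[n --> U] --> l.
  by move=> h A /h; exact: oU.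
have lim_le (f g : nat -> R) (a b : R) : f n @[n --> U] --> a ->
    g n @[n --> U] --> b -> (forall n, f n <= g n) -> a <= b.
  move=> fa gb fg; rewrite -(cvg_lim _ fa)// -(cvg_lim _ gb)//.
  apply: ler_lim; [by apply/cvg_ex; exists a|by apply/cvg_ex; exists b|].
  exact: nearW.
have sumcvg (F : {fset E}) (c : E -> R) :
    (\sum_(j <- F) nu n j * c j) @[n --> U] --> \sum_(j <- F) mu j * c j.
  apply: cvg_big => //; first exact: add_continuous.
  by move=> j _; apply: cvgMl; exact: mucvg.
have mu0 j : 0 <= mu j.
  by apply: (lim_le (fun=> 0) (fun n => nu n j)) => //; exact: cvg_cst.
have muF (F : {fset E}) : \sum_(j <- F) mu j <= 1.
  have -> : \sum_(j <- F) mu j = \sum_(j <- F) mu j * 1.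
    by apply: eq_bigr => j _; rewrite mulr1.
  apply: (lim_le _ (fun=> 1) _ _ (sumcvg F (fun=> 1))); first exact: cvg_cst.
  by move=> n; under eq_bigr do rewrite mulr1.
(* [drift_iter] divided by n+1: the term V_i/(n+1) vanishes in the limit, and since H is finite its
   mass passes to the limit. This is where escape of all the mass is excluded. *)
have muH : 0 < \sum_(j <- H) mu j.
  suff : 1 <= C * \sum_(j <- H) mu j.
    by rewrite -(pmulr_rgt0 _ C0); apply: lt_le_trans.
  have -> : \sum_(j <- H) mu j = \sum_(j <- H) mu j * 1.
    by apply: eq_bigr => j _; rewrite mulr1.
  have -> : C * (\sum_(j <- H) mu j * 1) = V i * 0 + C * (\sum_(j <- H) mu j * 1).
    by rewrite mulr0 add0r.
  apply: (lim_le (fun=> 1)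
    (fun n => V i * @harmonic R n + C * \sum_(j <- H) nu n j * 1)).
  - exact: cvg_cst.
  - apply: cvgD; apply: cvgMr; last exact: sumcvg.
    by apply: cvgU; exact: cvg_harmonic.
  - move=> n; have := hn n.+1; rewrite -(ler_pM2l (har0 n)) harn.
    move=> h; apply: le_trans h _; rewrite mulrDr mulrC lerD2l mulrCA.
    under [X in _ <= C * X]eq_bigr do rewrite mulr1.
    by rewrite -mulr_sumr exchange_big.
(* Multiplying a Cesaro mean by p(1) shifts it by one term, an excess of at most 1/(n+1). *)
have muP j : (\esum_(k in [set: E]) (mu k * p 1 k j)%:E <= (mu j)%:E)%E.
  apply: esum_le_fset => F; rewrite lee_fin.
  have -> : mu j = mu j + 0 by rewrite addr0.
  apply: (lim_le _ (fun n => nu n j + @harmonic R n) _ _ (sumcvg F (fun k => p 1 k j))).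
    by apply: cvgD; [exact: mucvg|apply: cvgU; exact: cvg_harmonic].
  move=> n; rewrite /nu.
  under eq_bigr do rewrite -mulrA.
  rewrite -mulr_sumr -[X in _ + X]mulr1 -mulrDr ler_wpM2l ?(ltW (har0 _))//.
  under eq_bigr do rewrite mulr_suml.
  rewrite exchange_big/=.
  apply: (@le_trans _ _ (\sum_(k < n.+1) p k.+2%:R i j)).
    apply: ler_sum => k _; rewrite -[k.+2%:R]natr1 -lee_fin p_ck//.
    exact: (fset_le_esum (fun l => p k.+1%:R i l * p 1 l j)).
  rewrite big_ord_recr/= [in leRHS]big_ord_recl/= [leRHS]addrAC.
  have -> : \sum_(k < n) p k.+2%:R i j = \sum_(k < n) p (bump 0 k).+1%:R i j.
    by apply: eq_bigr => k _.
  rewrite addrC lerD2r (le_trans (p_le1 p_ge0 p_honest _ _ _))//.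
  by rewrite lerDr p_ge0.
have [S SE] : exists S, \esum_(j in [set: E]) (mu j)%:E = S%:E.
  by apply: (esum_fin (c := 1)) => //; exact: esum_le_fset.
have S0 : 0 < S.
  by apply: lt_le_trans muH _; rewrite -lee_fin -SE; exact: fset_le_esum.
(* The nonnegative defect mu - mu p(1) has total mass S - S = 0, by honesty. *)
have muPE j : \esum_(k in [set: E]) (mu k * p 1 k j)%:E = (mu j)%:E.
  pose s l := fine (\esum_(k in [set: E]) (mu k * p 1 k l)%:E).
  have mup k l : 0 <= mu k * p 1 k l by rewrite mulr_ge0 ?p_ge0.
  have sE l : \esum_(k in [set: E]) (mu k * p 1 k l)%:E = (s l)%:E.
    by apply: esum_fineK (muP l).
  have s0 l : 0 <= s l.
    by rewrite -lee_fin -sE; apply: esum_ge0 => k _; rewrite lee_fin.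
  have smu l : 0 <= mu l - s l by rewrite subr_ge0 -lee_fin -sE.
  have sS : \esum_(l in [set: E]) (s l)%:E = S%:E.
    under eq_esum do rewrite -sE.
    rewrite esum_exchange; last by move=> x y; rewrite lee_fin.
    rewrite -SE; apply: eq_esum => k _; rewrite esumZr//; last first.
      by move=> l; exact: p_ge0.
    by rewrite p_honest// mule1.
  have e0 : \esum_(l in [set: E]) (mu l - s l)%:E = 0%E.
    have : \esum_(l in [set: E]) (s l + (mu l - s l))%:E = S%:E.
      by rewrite -SE; apply: eq_esum => l _; rewrite addrC subrK.
    rewrite esumDr// sS; case: (\esum_(l in _) _) => [r| |]//= [h].
    by congr EFin; lra.
  rewrite sE; congr EFin; apply/esym/eqP; rewrite -subr_eq0; apply/eqP.
  exact: (esum_eq0r _ smu e0).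
have SV0 : 0 <= S^-1 by rewrite invr_ge0 ltW.
apply: (@ergodic_of_stationary _ _ p _ _ _ _ _ (fun j => S^-1 * mu j)) => //.
- exact: Qprocess_gt0 hQ hp hirr.
- by move=> j; rewrite mulr_ge0.
- by rewrite esumZr// SE -EFinM mulVf// gt_eqF.
- move=> j; rewrite EFinM -muPE -esumZr//.
    by apply: eq_esum => k _; rewrite mulrA.
  by move=> k; rewrite mulr_ge0 ?p_ge0.
Qed.

Lemma ergodic_of_drift (H : {fset E}) (V : E -> R) (C : R) (i : E) :
  (forall i, 0 <= V i) -> 0 <= C ->
  (forall (A : {fset E}) i, i \in A ->
    \sum_(j <- A) q i j * V j <= -1 + C * (i \in H)%:R) ->
  ergodic p.
Proof.
move=> V0 C0 hV.
have [C' C'0 hC'] := drift_skeleton hQ hp hreg V0 C0 hV.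
exact: ergodic_of_skeleton_drift i V0 C'0 hC'.
Qed.

End Foster.

(** * Expected return times *)

Section ReturnTimes.
Context {R : realType} {E : countType} (q : E -> E -> R) (H : {fset E}).
Hypothesis hQ : Qmatrix q.
Local Notation Pi := (embedding_chain q).

Definition zero_on (y : E -> R) (j : E) : R := if j \in H then 0 else y j.

Lemma zero_on_ge0 y j : (forall j, 0 <= y j) -> 0 <= zero_on y j.
Proof. by move=> y0; rewrite /zero_on; case: ifP. Qed.

Lemma embedding_ge0 i j : 0 <= Pi i j.
Proof.
rewrite /embedding_chain; case: eqP => // /eqP ji.
rewrite divr_ge0// ?oppr_ge0 ?Qmatrix_diag_le0//.
by case: hQ => h _; apply: h; rewrite eq_sym.
Qed.

Lemma embedding_mul i j (c : R) : q i i != 0 ->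
  q i j * c = - q i i * (Pi i j * c) + (i == j)%:R * (q i i * c).
Proof.
move=> qi; rewrite /embedding_chain eq_sym; case: eqP => [->|_].
  by rewrite mul0r mulr0 add0r mul1r.
rewrite mul0r addr0 mulrA; congr (_ * _).
by rewrite mulrC divfK// oppr_eq0.
Qed.

Lemma sum_embedding (A : {fset E}) i (f : E -> R) : q i i != 0 -> i \in A ->
  \sum_(j <- A) q i j * f j = - q i i * \sum_(j <- A) Pi i j * f j + q i i * f i.
Proof.
move=> qi iA; under eq_bigr do rewrite (embedding_mul _ _ qi).
by rewrite big_split/= -mulr_sumr (sum_delta (fun k => q i i * f k) iA).
Qed.

(* Increases with n to E_i sigma_H. *)
Fixpoint return_iter (n : nat) (i : E) : R :=
  if n is m.+1 then
    if i \in initial_fset E n then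
      \sum_(j <- initial_fset E n) Pi i j * zero_on (return_iter m) j +
        (- q i i)^-1
    else 0
  else 0.

Lemma inv_rate_ge0 i : 0 <= (- q i i)^-1.
Proof. by rewrite invr_ge0 oppr_ge0 Qmatrix_diag_le0. Qed.

Lemma return_iter_ge0 n i : 0 <= return_iter n i.
Proof.
elim: n i => [//|n IH] i /=; case: ifP => // _.
rewrite addr_ge0 ?inv_rate_ge0// sumr_ge0// => j _.
by rewrite mulr_ge0 ?embedding_ge0 ?zero_on_ge0.
Qed.

Lemma return_iter_support n i : i \notin initial_fset E n -> return_iter n i = 0.
Proof. by case: n => [//|n] /= /negPf ->. Qed.

Lemma le_zero_on y z j : (forall i, y i <= z i) -> zero_on y j <= zero_on z j.
Proof. by move=> h; rewrite /zero_on; case: ifP. Qed.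

Lemma return_iter_leS n i : return_iter n i <= return_iter n.+1 i.
Proof.
elim: n i => [|n IH] i; first exact: return_iter_ge0.
have [iA|/return_iter_support ->] := boolP (i \in initial_fset E n.+1); last first.
  exact: return_iter_ge0.
have iB : i \in initial_fset E n.+2 by exact: initial_fset_sub iA.
rewrite [return_iter n.+1 i]/= [leRHS]/= iA iB lerD2r.
apply: (@le_trans _ _ (\sum_(j <- initial_fset E n.+1)
    Pi i j * zero_on (return_iter n.+1) j)).
  by apply: ler_sum => j _; rewrite ler_wpM2l ?embedding_ge0// le_zero_on.
apply: ler_sum_fset; first exact: initial_fset_sub.
move=> j; rewrite mulr_ge0 ?embedding_ge0 ?zero_on_ge0// => k.
exact: return_iter_ge0.
Qed.

Lemma return_iter_le m n i : (m <= n)%N -> return_iter m i <= return_iter n i.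
Proof.
have h : {homo return_iter^~ i : m n / (m <= n)%N >-> m <= n}.
  by apply/nondecreasing_seqP => k; exact: return_iter_leS.
exact: h.
Qed.

(** The iterates increase, so the equation that defines the new iterate from the old one turns into
    an inequality for the new one alone. *)
Lemma return_iter_sub n (B : {fset E}) i : {subset initial_fset E n <= B} ->
  return_iter n i <=
    \sum_(j <- B) Pi i j * zero_on (return_iter n) j + (- q i i)^-1.
Proof.
have pos (A : {fset E}) m : 0 <= \sum_(j <- A) Pi i j * zero_on (return_iter m) j.
  apply: sumr_ge0 => j _.
  by rewrite mulr_ge0 ?embedding_ge0 ?zero_on_ge0// => k; exact: return_iter_ge0.
move=> sub; case: n sub => [|n] sub.
  by rewrite addr_ge0 ?inv_rate_ge0.
have [iA|/return_iter_support ->] := boolP (i \in initial_fset E n.+1); last first.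
  by rewrite addr_ge0 ?inv_rate_ge0.
rewrite {1}/return_iter -/return_iter iA lerD2r.
apply: (@le_trans _ _ (\sum_(j <- initial_fset E n.+1)
    Pi i j * zero_on (return_iter n.+1) j)).
  apply: ler_sum => j _; rewrite ler_wpM2l ?embedding_ge0// le_zero_on// => k.
  exact: return_iter_leS.
apply: ler_sum_fset => // j.
by rewrite mulr_ge0 ?embedding_ge0 ?zero_on_ge0// => k; exact: return_iter_ge0.
Qed.

Lemma return_iter_super n (B : {fset E}) i : {subset B <= initial_fset E n.+1} ->
  i \in initial_fset E n.+1 ->
  \sum_(j <- B) Pi i j * zero_on (return_iter n) j + (- q i i)^-1 <=
    return_iter n.+1 i.
Proof.
move=> sub iA; rewrite [leRHS]/= iA lerD2r; apply: ler_sum_fset => // j.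
by rewrite mulr_ge0 ?embedding_ge0 ?zero_on_ge0// => k; exact: return_iter_ge0.
Qed.

Lemma signed_esum_zero_on (f g : E -> R) :
  (forall j, 0 <= f j) -> (forall j, 0 <= g j) ->
  signed_esum [set j | j \notin H] (fun j => f j * g j) =
  \esum_(j in [set: E]) (f j * zero_on g j)%:E.
Proof.
move=> f0 g0; have fg0 j : 0 <= f j * g j by rewrite mulr_ge0.
rewrite /signed_esum [X in (_ - X)%E]esum1 ?sube0; last first.
  by move=> j _; congr EFin; apply/max_idPr; rewrite oppr_le0.
rewrite esum_mkcond; apply: eq_esum => j _; rewrite /zero_on.
have [jH|jH] := boolP (j \in H); rewrite ?mulr0.
  by rewrite memNset//=; apply/negP; rewrite negbK.
by rewrite mem_set//; congr EFin; apply/max_idPl.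
Qed.

Lemma return_iter_drift n : drift_inequality q H (return_iter n).
Proof.
move=> i; rewrite signed_esum_zero_on; last 2 first.
- exact: embedding_ge0.
- exact: return_iter_ge0.
apply: le_trans (leeD (fset_le_esum _ (initial_fset E n)) (lexx _)).
by rewrite -EFinD lee_fin; exact: return_iter_sub.
Qed.

Lemma return_iter_bounded n :
  (ereal_sup [set (return_iter n i)%:E | i in [set: E]] < +oo)%E.
Proof.
apply: (@le_lt_trans _ _ (\sum_(j <- initial_fset E n) return_iter n j)%:E).
  apply: ge_ereal_sup => _ [i _ <-]; rewrite lee_fin.
  have [iA|/return_iter_support ->] := boolP (i \in initial_fset E n).
    by apply: ler_sum_at => // j; exact: return_iter_ge0.
  by apply: sumr_ge0 => j _; exact: return_iter_ge0.
by rewrite ltry.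
Qed.

Definition finite_return i := exists K, forall n, return_iter n i <= K.

(** The iterate at [i] is at least Pi_ij times the preceding iterate at [j]; for j in H that term
    would have been zeroed. *)
Lemma finite_return_step i j : finite_return i -> 0 < q i j -> j \notin H ->
  finite_return j.
Proof.
move=> [K hK] qij jH.
have ij : i != j.
  apply: contraTneq qij => ->; rewrite -leNgt; exact: Qmatrix_diag_le0.
have qi : 0 < - q i i.
  apply: lt_le_trans qij _; rewrite -lee_fin; case: hQ => q0 <-.
  apply: esum_ge; exists [set j]; last by rewrite fsbig_set1.
  by split => // k ->; rewrite /= eq_sym.
have Pij : 0 < Pi i j.
  by rewrite /embedding_chain eq_sym (negPf ij) divr_gt0.
exists (K / Pi i j) => n.
pose m := maxn n (maxn (choice.pickle i) (choice.pickle j)).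
have iA : i \in initial_fset E m.+1.
  by rewrite in_initial_fset ltnS /m !leq_max leqnn ?orbT.
have jA : j \in initial_fset E m.+1.
  by rewrite in_initial_fset ltnS /m !leq_max leqnn ?orbT.
apply: (@le_trans _ _ (return_iter m j)).
  by apply: return_iter_le; rewrite leq_maxl.
rewrite ler_pdivlMr// mulrC; apply: le_trans (hK m.+1).
have sub : {subset [fset j]%fset <= initial_fset E m.+1}.
  by move=> k; rewrite inE => /eqP ->.
apply: le_trans (return_iter_super sub iA).
by rewrite big_seq_fset1 /zero_on (negPf jH) lerDl inv_rate_ge0.
Qed.

Lemma supersolution (hirr : Qirreducible q) : H != fset0 ->
  (forall i, i \in H -> finite_return i) ->
  exists V : E -> R, (forall i, 0 <= V i) /\
    forall (A : {fset E}) i,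
      \sum_(j <- A) Pi i j * zero_on V j + (- q i i)^-1 <= V i.
Proof.
move=> /fset0Pn[h hH] bH.
have bE i : finite_return i.
  have [s [qs <-]] := hirr h i.
  (* Finiteness propagates along the path through states outside H, and is given afresh whenever the
     path re-enters H. *)
  elim: s h {hH} (bH h hH) qs => [//|k s IH] h bh /= /andP[qhk qs].
  apply: IH => //; have [kH|kH] := boolP (k \in H); first exact: bH.
  exact: finite_return_step qhk kH.
pose V i := sup (range (fun n => return_iter n i)).
have cvV i : return_iter n i @[n --> \oo] --> V i.
  apply: nondecreasing_cvgn; first by move=> m n; exact: return_iter_le.
  by have [K hK] := bE i; exists K => _ [n _ <-].
have leV n i : return_iter n i <= V i.
  apply: sup_ubound; last by exists n.
  by have [K hK] := bE i; exists K => _ [m _ <-].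
exists V; split => [i|A i]; first exact: le_trans (leV 0%N i).
have cv : (\sum_(j <- A) Pi i j * zero_on (return_iter n) j + (- q i i)^-1)
    @[n --> \oo] --> \sum_(j <- A) Pi i j * zero_on V j + (- q i i)^-1.
  apply: cvgD; last exact: cvg_cst.
  apply: cvg_big => //; first exact: add_continuous.
  move=> j _; apply: cvgMr; rewrite /zero_on; case: ifP => _; last exact: cvV.
  exact: cvg_cst.
rewrite -(cvg_lim _ cv)//; apply: limr_le.
  by apply/cvg_ex; eexists; exact: cv.
near=> n; apply: le_trans (leV n.+1 i); apply: return_iter_super.
  move=> k kA; apply: (initial_fset_sub (leqnSn n)); move: k kA.
  by near: n; exact: near_sub_initial_fset.
apply: (initial_fset_sub (leqnSn n)).
by near: n; exact: near_in_initial_fset.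
Unshelve. all: by end_near.
Qed.

(** Multiply by q_i. Off H this gives drift at most -1; at i in H the function vanishes and the
    drift is at most q_i V_i - 1, which the sum over the finite H bounds. *)
Lemma supersolution_drift (V : E -> R) : (forall i, q i i != 0) ->
  (forall i, 0 <= V i) ->
  (forall (A : {fset E}) i,
     \sum_(j <- A) Pi i j * zero_on V j + (- q i i)^-1 <= V i) ->
  exists2 C, 0 <= C & forall (A : {fset E}) i, i \in A ->
    \sum_(j <- A) q i j * zero_on V j <= -1 + C * (i \in H)%:R.
Proof.
move=> q0 V0 hV; have qn0 i : 0 <= - q i i by rewrite oppr_ge0 Qmatrix_diag_le0.
have qV0 i : 0 <= - q i i * V i by rewrite mulr_ge0.
exists (\sum_(h <- H) (- q h h * V h)) => [|A i iA].
  by apply: sumr_ge0 => h _.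
rewrite (sum_embedding _ (q0 i) iA).
have : - q i i * (\sum_(j <- A) Pi i j * zero_on V j + (- q i i)^-1) <= - q i i * V i.
  by rewrite ler_wpM2l.
rewrite mulrDr divff ?oppr_eq0// {3}/zero_on; case: ifPn => iH.
  have := ler_sum_at (F := fun h => - q h h * V h) iH qV0.
  by rewrite mulr1 mulr0; set x := - _ * \sum_(_ <- _) _; set y := \sum_(_ <- _) _; lra.
by rewrite mulr0; set x := - _ * \sum_(_ <- _) _; rewrite mulNr; lra.
Qed.

End ReturnTimes.

(** * Comparison with the expected return time *)

Section Comparison.
Context {R : realType} {E : countType} (q : E -> E -> R) (H : {fset E}).
Context (p : R -> E -> E -> R).
Hypothesis hQ : Qmatrix q.
Hypothesis hirr : Qirreducible q.
Hypothesis hreg : Qregular q.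
Hypothesis hp : Qprocess q p.
Hypothesis q_neq0 : forall i, q i i != 0.
Variable mu : E -> R.
Hypothesis hmu : stationary_distribution p mu.
Local Notation Pi := (embedding_chain q).

Let p_ge0 := Qprocess_ge0 hp.

Let p1_gt0 i j : 0 < p 1 i j := Qprocess_gt0 hQ hp hirr i j.

Let p_honest : honest p := regular_honest hp hreg.

Let mu_ge0 i : 0 <= mu i.
Proof. by case: hmu. Qed.

Let mu1 : \esum_(i in [set: E]) (mu i)%:E = 1%E.
Proof. by case: hmu. Qed.

Let muP (t : R) j : 0 <= t ->
  \esum_(i in [set: E]) (mu i * p t i j)%:E = (mu j)%:E.
Proof. by case: hmu => _ _ h; exact: h. Qed.

Let mu_gt0 := stationary_gt0 p1_gt0 mu_ge0 mu1 (fun j => muP j ler01).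

Let rate_gt0 i : 0 < - q i i.
Proof. by rewrite oppr_gt0 lt_neqAle q_neq0 Qmatrix_diag_le0. Qed.

Let Pi_ge0 i j : 0 <= Pi i j := embedding_ge0 hQ i j.

(** Invariance under p(t), restricted to the rows in B, is an inequality between finite sums that
    can be differentiated at t = 0. Since [j] lies in B, the mass mu_j is fully subtracted. *)
Lemma stationary_subinvariant (B : {fset E}) j : j \in B ->
  \sum_(i <- B) mu i * q i j <= 0.
Proof.
move=> jB.
have cv : (\sum_(i <- B) mu i * ((p t i j - (i == j)%:R) / t)) @[t --> 0^'+] -->
    \sum_(i <- B) mu i * q i j.
  apply: cvg_big => //; first exact: add_continuous.
  by move=> i _; apply: cvgMr; case: hp => _ _ _ _; exact.
rewrite -(cvg_lim _ cv)//; apply: limr_le.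
  by apply/cvg_ex; eexists; exact: cv.
near=> t.
have t0 : 0 < t by near: t; exact: nbhs_right_gt.
under eq_bigr do rewrite mulrA.
rewrite -mulr_suml ler_pdivrMr// mul0r.
under eq_bigr do rewrite mulrBr.
rewrite sumrB subr_le0.
have -> : \sum_(i <- B) mu i * (i == j)%:R = mu j.
  under eq_bigr do rewrite mulrC eq_sym.
  by rewrite sum_delta.
rewrite -lee_fin -(muP _ (ltW t0)).
exact: (fset_le_esum (fun i => mu i * p t i j)).
Unshelve. all: by end_near.
Qed.

(** The upper half of Kac's formula, according to which the sum over h in H of mu_h q_h E_h sigma_H
    is 1. *)
Lemma finite_return_of_stationary h : h \in H -> finite_return q H h.
Proof.
move=> hH; exists (mu h * - q h h)^-1 => n.
have muq : 0 < mu h * - q h h by rewrite mulr_gt0.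
pose x := return_iter q H n.
have x0 i : 0 <= x i by exact: return_iter_ge0.
(* Contains the support of x, so that the sums over B lose nothing. *)
pose B := (initial_fset E n `|` [fset h])%fset.
have sub : {subset initial_fset E n <= B} by move=> k kA; rewrite inE kA.
have hB : h \in B by rewrite !inE eqxx orbT.
have flow i : i \in B ->
    (i \in H)%:R * (- q i i * x i) - 1 <= \sum_(j <- B) q i j * zero_on H x j.
  move=> iB; rewrite (sum_embedding _ (q_neq0 i) iB).
  have := return_iter_sub H hQ i sub; rewrite -/x -(ler_pM2l (rate_gt0 i)).
  rewrite mulrDr divff ?oppr_eq0//.
  set y := - _ * \sum_(_ <- _) _; rewrite /zero_on; case: ifP => _.
    by rewrite mul1r mulr0; lra.
  by rewrite mul0r mulNr; lra.
have T0 : \sum_(i <- B) mu i * \sum_(j <- B) q i j * zero_on H x j <= 0.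
  have -> : \sum_(i <- B) mu i * \sum_(j <- B) q i j * zero_on H x j =
      \sum_(j <- B) (\sum_(i <- B) mu i * q i j) * zero_on H x j.
    under eq_bigr do rewrite mulr_sumr.
    rewrite exchange_big/=; apply: eq_bigr => j _.
    by rewrite mulr_suml; apply: eq_bigr => i _; rewrite mulrA.
  rewrite big_seq; apply: sumr_le0 => j jB.
  rewrite mulr_le0_ge0 ?stationary_subinvariant//.
  exact: zero_on_ge0.
have le1 : \sum_(i <- B) mu i <= 1.
  by rewrite -lee_fin -mu1; exact: fset_le_esum.
have : \sum_(i <- B) mu i * ((i \in H)%:R * (- q i i * x i) - 1) <= 0.
  apply: le_trans T0; apply: ler_sum_in => i iB.
  by rewrite ler_wpM2l// flow.
under eq_bigr do rewrite mulrBr mulr1.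
rewrite sumrB subr_le0 => le2.
have := ler_sum_at (F := fun i => mu i * ((i \in H)%:R * (- q i i * x i))) hB.
rewrite hH mul1r => le3.
rewrite -div1r ler_pdivlMr// mulrC -mulrA.
apply: le_trans (le3 _) (le_trans le2 le1) => i.
by rewrite !mulr_ge0 ?(ltW (rate_gt0 _)).
Qed.

Lemma esum_embedding_le1 i : (\esum_(j in [set: E]) (Pi i j)%:E <= 1)%E.
Proof.
have h : \esum_(j in [set: E]) (- q i i * Pi i j)%:E = (- q i i)%:E.
  case: hQ => _ <-; rewrite [RHS]esum_mkcond; apply: eq_esum => j _.
  rewrite /embedding_chain; case: eqP => [->|/eqP ji].
    by rewrite mulr0 memNset//= eqxx.
  by rewrite mem_set// mulrC divfK// gt_eqF.
move: h; rewrite esumZr ?(ltW (rate_gt0 _))//.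
case: (\esum_(j in _) _) => [r| |]//=.
- move=> [] /eqP; rewrite -[X in _ == X]mulr1 => /eqP/mulfI.
  by rewrite gt_eqF// => /(_ isT) ->.
- by rewrite gt0_muley ?lte_fin.
- by rewrite leNye.
Qed.

(** As the rows of [Pi] have mass at most 1, averaging M - u 1_(H^c) gives at most M - u. The
    function is nonnegative, so truncation to A only lowers its average; for -u 1_(H^c) alone
    truncation would go the wrong way. *)
Lemma zero_on_superharmonic (u : E -> R) (M : R) :
  (forall i, 0 <= u i <= M) ->
  (forall i, ((u i)%:E <= \esum_(j in [set: E]) (Pi i j * zero_on H u j)%:E)%E) ->
  forall (A : {fset E}) i, i \in A ->
    \sum_(j <- A) q i j * (M - zero_on H u j) <= 0.
Proof.
move=> u0M hu A i iA.
have z0 j : 0 <= zero_on H u j.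
  by apply: zero_on_ge0 => k; case/andP: (u0M k).
have M0 : 0 <= M by case/andP: (u0M i) => h; exact: le_trans.
have zM j : zero_on H u j <= M.
  by rewrite /zero_on; case: ifP => // _; case/andP: (u0M j).
have zu : zero_on H u i <= u i.
  by rewrite /zero_on; case: ifP => // _; case/andP: (u0M i).
rewrite (sum_embedding _ (q_neq0 i) iA).
have : \sum_(j <- A) Pi i j * (M - zero_on H u j) <= M - zero_on H u i.
  rewrite -lee_fin.
  apply: le_trans (fset_le_esum (fun j => Pi i j * (M - zero_on H u j)) A) _.
  have : (\esum_(j in [set: E])
      (Pi i j * (M - zero_on H u j) + Pi i j * zero_on H u j)%:E
      <= M%:E)%E.
    rewrite -[leRHS]mule1.
    apply: le_trans (lee_wpmul2l _ (esum_embedding_le1 i)); last first.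
      by rewrite lee_fin.
    rewrite -esumZr//; apply: le_esum => j _; rewrite lee_fin.
    by rewrite -mulrDr subrK mulrC.
  rewrite esumDr; last 2 first.
  - by move=> j; rewrite mulr_ge0// subr_ge0.
  - by move=> j; rewrite mulr_ge0.
  move: (hu i); case: (\esum_(x in _) (_ * zero_on _ _ _)%:E) => [r| |]//.
    case: (\esum_(x in [set: E]) _) => [r'| |]//; last by move=> _ _; rewrite leNye.
    by rewrite -EFinD !lee_fin; lra.
  by case: (\esum_(x in [set: E]) _) => [r'| |]// _ _; rewrite leNye.
move=> h; have := ler_wpM2l (ltW (rate_gt0 i)) h.
by rewrite mulNr [leRHS]mulNr; set a := q i i * \sum_(_ <- _) _; lra.
Qed.

Lemma skeleton_superharmonic (G : E -> R) : (forall i, 0 <= G i) ->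
  (forall (A : {fset E}) i, i \in A -> \sum_(j <- A) q i j * G j <= 0) ->
  forall i, (\esum_(j in [set: E]) (p 1 i j * G j)%:E <= (G i)%:E)%E.
Proof.
move=> G0 hG i.
have fin (A : {fset E}) : i \in A -> \sum_(j <- A) confined p A 1 i j * G j <= G i.
  move=> iA; apply/ler_addgt0Pr => e e0.
  have [n hn] := confined_drift hp (g := fun=> 0) G0 e0 (hG A) iA.
  have n0 : (0 : R) < n.+1%:R by [].
  have h0 : (0 : R) <= n.+1%:R^-1 by rewrite invr_ge0 ltW.
  apply: le_trans hn _; rewrite lerD2l.
  apply: (@le_trans _ _ (n.+1%:R^-1 * \sum_(m < n.+1) e)).
    rewrite ler_wpM2l//; apply: ler_sum => m _.
    rewrite add0r -mulr_suml ler_piMl ?(ltW e0)//.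
    have pw := partition_of_nseq m h0.
    apply: le_trans (sum_Qprocess_le1 hp A i (partition_of_ge0 pw)).
    apply: ler_sum => j _; case: hp => ? _ ? ? _.
    exact: watched_le.
  by rewrite sumr_const card_ord -[X in _ * X <= _]mulr_natr mulrC mulfK// gt_eqF.
apply: esum_le_fset => F; rewrite lee_fin.
have cv : (\sum_(j <- F) confined p (initial_fset E n) 1 i j * G j)
    @[n --> \oo] --> \sum_(j <- F) p 1 i j * G j.
  apply: cvg_big => //; first exact: add_continuous.
  by move=> j _; apply: cvgMl; exact: (cvg_confined hQ hp hreg).
rewrite -(cvg_lim _ cv)//; apply: limr_le.
  by apply/cvg_ex; eexists; exact: cv.
near=> n; apply: le_trans (fin (initial_fset E n) _).
  apply: ler_sum_fset; first by near: n; exact: near_sub_initial_fset.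
  by move=> j; rewrite mulr_ge0 ?confined_ge0.
by near: n; exact: near_in_initial_fset.
Unshelve. all: by end_near.
Qed.

Lemma drift_excess (V y : E -> R) (M : R) :
  (forall i, 0 <= V i) -> (forall i, y i <= M) -> 0 <= M ->
  (forall (A : {fset E}) i,
     \sum_(j <- A) Pi i j * zero_on H V j + (- q i i)^-1 <= V i) ->
  drift_inequality q H y ->
  forall i, ((Num.max 0 (y i - V i))%:E <=
    \esum_(j in [set: E])
      (Pi i j * zero_on H (fun k => Num.max 0 (y k - V k)) j)%:E)%E.
Proof.
move=> V0 yM M0 hV hy i; pose u k := Num.max 0 (y k - V k).
have u0 k : 0 <= u k by rewrite le_max lexx.
have yu k : y k <= V k + u k by rewrite addrC -lerBlDr le_max lexx orbT.
rewrite -(signed_esum_zero_on H (Pi_ge0 i) u0).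
have sE (f : E -> R) : (forall j, 0 <= f j) ->
    signed_esum [set j | j \notin H] (fun j => Pi i j * f j) =
    \esum_(j in [set j | j \notin H]) (Pi i j * f j)%:E.
  move=> f0; rewrite /signed_esum [X in (_ - X)%E]esum1 ?sube0.
    by apply: eq_esum => j _; congr EFin; apply/max_idPl; rewrite mulr_ge0.
  by move=> j _; congr EFin; apply/max_idPr; rewrite oppr_le0 mulr_ge0.
pose D := [set j | j \notin H].
rewrite sE// -/D.
have VD : (\esum_(j in D) (Pi i j * V j)%:E + ((- q i i)^-1)%:E <= (V i)%:E)%E.
  rewrite -sE// signed_esum_zero_on// -leeBrDr//; apply: esum_le_fset => A.
  by rewrite -EFinB lee_fin lerBrDr.
(* y <= V + u, written additively so that no possibly infinite sum is subtracted. *)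
have pos : (\esum_(j in D) (Num.max (Pi i j * y j) 0)%:E <=
    \esum_(j in D) (Num.max (- (Pi i j * y j)) 0)%:E +
    \esum_(j in D) (Pi i j * V j)%:E + \esum_(j in D) (Pi i j * u j)%:E)%E.
  have m0 (x : R) : 0 <= Num.max x 0 by rewrite le_max lexx orbT.
  have Pf0 (f : E -> R) j : (forall j, 0 <= f j) -> 0 <= Pi i j * f j.
    by move=> f0; rewrite mulr_ge0.
  rewrite -!esumD; last first.
  - by move=> j _; rewrite lee_fin ?Pf0 ?m0.
  - by move=> j _; rewrite lee_fin ?Pf0 ?m0.
  - by move=> j _; rewrite lee_fin ?Pf0 ?m0.
  - by move=> j _; rewrite -EFinD lee_fin addr_ge0 ?Pf0 ?m0.
  apply: le_esum => j _; rewrite -!EFinD lee_fin.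
  have := ler_wpM2l (Pi_ge0 i j) (yu j); rewrite mulrDr.
  by rewrite /Num.max; case: ifP; case: ifP; lra.
have := hy i; rewrite /signed_esum -/D.
have U0 : (0 <= \esum_(j in D) (Pi i j * u j)%:E)%E.
  by apply: esum_ge0 => j _; rewrite lee_fin mulr_ge0.
have N0 : (0 <= \esum_(j in D) (Num.max (- (Pi i j * y j)) 0)%:E)%E.
  by apply: esum_ge0 => j _; rewrite lee_fin le_max lexx orbT.
have P0 : (0 <= \esum_(j in D) (Num.max (Pi i j * y j) 0)%:E)%E.
  by apply: esum_ge0 => j _; rewrite lee_fin le_max lexx orbT.
have W0 : (0 <= \esum_(j in D) (Pi i j * V j)%:E)%E.
  by apply: esum_ge0 => j _; rewrite lee_fin mulr_ge0.
move: pos VD U0 N0 P0 W0.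
case: (\esum_(j in D) (Pi i j * u j)%:E) => [ru| |]//; last by move=> *; rewrite leey.
(* An infinite negative part would make the right side of the drift inequality -oo, while y_i is
   real. *)
case: (\esum_(j in D) (Num.max (- _) 0)%:E) => [rn| |]//; last first.
  by case: (\esum_(j in D) (Num.max _ 0)%:E) => [rp| |]//.
case: (\esum_(j in D) (Pi i j * V j)%:E) => [rv| |]//.
case: (\esum_(j in D) (Num.max _ 0)%:E) => [rp| |]//.
rewrite -!EFinD !lee_fin => h1 h2 h3 _ _ _ h4.
rewrite ge_max h3/=; move: h1 h2 h4; move: (_^-1) => c; lra.
Qed.

Lemma drift_le_supersolution (V y : E -> R) : (forall i, 0 <= V i) ->
  (forall (A : {fset E}) i,
     \sum_(j <- A) Pi i j * zero_on H V j + (- q i i)^-1 <= V i) ->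
  (ereal_sup [set (y i)%:E | i in [set: E]] < +oo)%E ->
  drift_inequality q H y ->
  forall h, h \in H -> y h <= V h.
Proof.
move=> V0 hV ysup hy h hH.
have [M [M0 yM]] : exists M, 0 <= M /\ forall i, y i <= M.
  have le i : ((y i)%:E <= ereal_sup [set (y i)%:E | i in [set: E]])%E.
    by apply: ereal_sup_ubound; exists i.
  move: ysup le; case: (ereal_sup _) => [r| |]// _ le.
    exists (Num.max 0 r); split => [|i]; first by rewrite le_max lexx.
    by rewrite le_max -[y i <= r]lee_fin le orbT.
  by exists 0; split => // i; have := le i; rewrite leeNy_eq.
pose u k := Num.max 0 (y k - V k).
have u0M k : 0 <= u k <= M.
  rewrite le_max lexx/= ge_max M0/= lerBlDr.
  by apply: le_trans (yM k) _; rewrite lerDl.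
have hu := drift_excess V0 yM M0 hV hy.
have G0 i : 0 <= M - zero_on H u i.
  by rewrite subr_ge0 /zero_on; case: ifP => // _; case/andP: (u0M i).
have GM : forall i, M - zero_on H u i = M.
  apply: (@max_principle _ _ (p 1) mu (fun i => M - zero_on H u i) M h) => //.
  - by move=> i; exact: p_honest.
  - by move=> j; exact: muP.
  - move=> i; rewrite G0/= gerBl; apply: zero_on_ge0 => k.
    by case/andP: (u0M k).
  - apply: skeleton_superharmonic => // A i iA.
    exact: (zero_on_superharmonic u0M hu).
  - by rewrite /zero_on hH subr0.
have z0 j : zero_on H u j = 0 by have := GM j; lra.
(* So far u vanishes only off H; as the sum in [hu] sees only states off H, this carries over to
   [h]. *)
have : ((u h)%:E <= 0)%E.
  apply: le_trans (hu h) _; rewrite esum1// => j _.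
  by rewrite -/u z0 mulr0.
by rewrite lee_fin /u ge_max => /andP[_]; rewrite subr_le0.
Qed.

End Comparison.

(** * Maxima over H: supremum versus upper limit *)

Section MaxOn.
Context {R : realType} {E : countType}.
Implicit Types (H : {fset E}) (y : E -> R).

Lemma le_max_on H y h : h \in H -> ((y h)%:E <= max_on H y)%E.
Proof.
rewrite /max_on -[h \in H]/(h \in enum_fset H).
elim: (enum_fset H) => [//|k s IH].
rewrite inE big_cons le_max => /orP[/eqP ->|/IH ->]; first by rewrite lexx.
by rewrite orbT.
Qed.

Lemma max_on_le H y (c : \bar R) : (forall h, h \in H -> ((y h)%:E <= c)%E) ->
  (max_on H y <= c)%E.
Proof.
rewrite /max_on => hc; rewrite big_seq; elim/big_ind: _ => //.
- by rewrite leNye.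
- by move=> a b ac bc; rewrite ge_max ac bc.
Qed.

Lemma max_on_lty H y : (max_on H y < +oo)%E.
Proof.
rewrite /max_on; elim/big_ind: _ => //.
- by move=> a b ac bc; rewrite gt_max ac bc.
- by move=> i _; rewrite ltry.
Qed.

(** Finitely many terms below +oo have a bound below +oo, so discarding them leaves an infinite
    supremum infinite. *)
Lemma limn_esup_pinfty (u : nat -> \bar R) : (forall n, u n < +oo)%E ->
  ereal_sup [set u n | n in [set: nat]] = +oo%E <-> limn_esup u = +oo%E.
Proof.
move=> uoo; split=> [supu|limu]; last first.
  apply/eqP; rewrite -leye_eq -limu; apply: ereal_inf_lbound.
  by exists [set: nat]; first exact: filterT.
apply/eqP; rewrite -leye_eq; apply: le_ereal_inf_tmp => _ [V [N _ NV] <-].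
rewrite leye_eq; apply/eqP.
have [c [coo hc]] : exists c : \bar R, (c < +oo)%E /\
    forall n, (n < N)%N -> (u n <= c)%E.
  elim: N {NV} => [|N [c [coo hc]]]; first by exists -oo%E.
  exists (maxe c (u N)); split => [|n]; first by rewrite gt_max coo uoo.
  rewrite ltnS leq_eqVlt le_max => /orP[/eqP ->|/hc ->//].
  by rewrite lexx orbT.
apply/eqP; rewrite -leye_eq leNgt; apply/negP => soo.
suff : (ereal_sup [set u n | n in [set: nat]] < +oo)%E by rewrite supu.
apply: (@le_lt_trans _ _ (maxe c (ereal_sup [set u x | x in V]))).
  apply: ge_ereal_sup => _ [n _ <-]; rewrite le_max.
  have [/hc ->//|Nn] := ltnP n N.
  apply/orP; right; apply: ereal_sup_ubound; exists n => //.
  exact: NV.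
by rewrite gt_max coo.
Qed.

End MaxOn.

(** * The one-point state space and the two implications *)

Section Main.
Context {R : realType} {E : countType} (q : E -> E -> R) (H : {fset E}).
Context (p : R -> E -> E -> R).
Hypothesis hQ : Qmatrix q.
Hypothesis hirr : Qirreducible q.
Hypothesis hreg : Qregular q.
Hypothesis hp : Qprocess q p.
Hypothesis hH : H != fset0.

Lemma absorbing_singleton i : q i i = 0 -> forall j, j = i.
Proof.
move=> qi j; have [s [qs <-]] := hirr i j; case: s qs => [//|k s] /= /andP[qik _].
have [q0 /(_ i)] := hQ; rewrite qi oppr0 => e.
have ik : k != i by apply: contraTneq qik => ->; rewrite qi ltxx.
have : ((q i k)%:E <= \esum_(j in [set j | j != i]) (q i j)%:E)%E.
  apply: esum_ge; exists [set k]; last by rewrite fsbig_set1.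
  by split => // l ->.
by rewrite e lee_fin leNgt qik.
Qed.

Lemma absorbing_in i : q i i = 0 -> i \in H.
Proof.
by move=> /absorbing_singleton s; have /fset0Pn[h] := hH; rewrite (s h).
Qed.

Lemma ergodic_of_absorbing i : q i i = 0 -> ergodic p.
Proof.
move=> qi; have iH := absorbing_in qi.
apply: (@ergodic_of_drift _ _ q p hQ hirr hreg hp H (fun=> 0) 1 i) => //.
move=> A j _; rewrite (absorbing_singleton qi j) iH mulr1 addNr.
by rewrite big1// => k _; rewrite mulr0.
Qed.

(* Here 1 / q_i = 0, as the inverse of 0 is 0. *)
Lemma drift_absorbing i y : q i i = 0 -> drift_inequality q H y -> y i <= 0.
Proof.
move=> qi /(_ i); rewrite /signed_esum qi oppr0 invr0 adde0.
have -> : [set j | j \notin H] = set0.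
  apply/seteqP; split => // j /=.
  by rewrite (absorbing_singleton qi j) (absorbing_in qi).
by rewrite !esum_set0 sube0 lee_fin.
Qed.

Lemma ergodic_of_finite_return : (forall i, q i i != 0) ->
  (forall h, h \in H -> finite_return q H h) -> ergodic p.
Proof.
move=> q0 bH; have [V [V0 hV]] := supersolution hQ hirr hH bH.
have [C C0 hC] := supersolution_drift hQ q0 V0 hV.
have /fset0Pn[h _] := hH.
apply: (ergodic_of_drift hQ hirr hreg hp h _ C0 hC) => j.
exact: zero_on_ge0.
Qed.

Lemma ergodic_drift_bounded : ergodic p ->
  exists K : R, forall y, (ereal_sup [set (y i)%:E | i in [set: E]] < +oo)%E ->
    drift_inequality q H y -> forall h, h \in H -> y h <= K.
Proof.
move=> erg; have [[i qi]|nq] := pselect (exists i, q i i = 0).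
  exists 0 => y _ hy h _; rewrite (absorbing_singleton qi h).
  exact: drift_absorbing.
have q0 i : q i i != 0 by apply/eqP => qi; apply: nq; exists i.
have [mu [hmu _]] := erg.
have [V [V0 hV]] := supersolution hQ hirr hH
  (finite_return_of_stationary hQ hirr hp q0 hmu).
(* V does not depend on y, so the bound is uniform over all solutions; the sum stands in for the
   maximum over H. *)
exists (\sum_(h <- H) V h) => y ysup hy h hh.
apply: le_trans (ler_sum_at hh V0).
exact: (drift_le_supersolution hQ hirr hreg hp q0 hmu V0 hV ysup hy hh).
Qed.

End Main.

Theorem theorem1 (R : realType) (E : countType) (q : E -> E -> R)
    (H : {fset E}) (p : R -> E -> E -> R)
    (hQ : Qmatrix q) (hirr : Qirreducible q) (hreg : Qregular q)
    (hp : Qprocess q p) (hH : H != fset0) :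
  (~ ergodic p <->
    exists y : nat -> E -> R,
      (forall n, (ereal_sup [set (y n i)%:E | i in [set: E]] < +oo)%E /\
                 drift_inequality q H (y n)) /\
      ereal_sup [set max_on H (y n) | n in [set: nat]] = +oo%E)
  /\
  (forall y : nat -> E -> R,
      ereal_sup [set max_on H (y n) | n in [set: nat]] = +oo%E <->
      limn_esup (fun n => max_on H (y n)) = +oo%E).
Proof.
split; last first.
  by move=> y; apply: limn_esup_pinfty => n; exact: max_on_lty.
split => [nerg|[y [hy supy]] erg]; last first.
  have [K hK] := ergodic_drift_bounded hQ hirr hreg hp hH erg.
  suff : (+oo <= K%:E)%E by [].
  rewrite -supy; apply: ge_ereal_sup => _ [n _ <-]; apply: max_on_le => h hh.
  by have [ysup yd] := hy n; rewrite lee_fin; exact: hK.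
exists (return_iter q H); split.
  by move=> n; split; [exact: return_iter_bounded|exact: return_iter_drift].
(* If the iterates stayed bounded on H, the process would be ergodic. *)
apply: contrapT => /eqP supx; apply: nerg.
have [[i qi]|nq] := pselect (exists i, q i i = 0).
  exact: (ergodic_of_absorbing hQ hirr hreg hp hH qi).
apply: (ergodic_of_finite_return hQ hirr hreg hp hH).
  by move=> i; apply/eqP => qi; apply: nq; exists i.
move=> h hh.
have le n : ((return_iter q H n h)%:E <=
    ereal_sup [set max_on H (return_iter q H n) | n in [set: nat]])%E.
  apply: le_trans (le_max_on _ hh) _.
  by apply: ereal_sup_ubound; exists n.
move: supx le; case: (ereal_sup _) => [r| |]// _ le; first by exists r.
by have := le 0%N; rewrite leeNy_eq.
Qed.
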